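(* Let $L>0$, let $\omega>4\pi^2/L^2$, and let $\varphi=\varphi_\omega$ be the cnoidal solution of $-\varphi''+\omega\varphi-\varphi^5=0$. Let $\mathcal{L}_e$ be the restriction of $$\mathcal{L}=\begin{pmatrix}-\partial_x^2+\omega-5\varphi^4 & 0\\ 0 & -\partial_x^2+\omega-\varphi^4\end{pmatrix}$$ to even functions, with domain $H^2_{per,e}\times H^2_{per,e}\subset L^2_{per,e}\times L^2_{per,e}$. Then: - $\mathcal{L}_e$ has exactly three negative eigenvalues, each simple; - zero is a simple eigenvalue of $\mathcal{L}_e$ with eigenfunction $(0,\varphi)$; - the remainder of the spectrum is a discrete set of eigenvalues.
   Context: For $k\in(0,1)$: $s(k)=\sqrt{k^4-k^2+1}$, $q(k)=k^2-1-s(k)$, $b(k)=4{\rm K}(k)/L$, and $$a(k)=\frac{2({\rm K}(k)^2(k^2-1-s)(-k^2-1-s)L^2)^{1/4}}{L},\qquad \omega(k)=\frac{-16{\rm K}(k)^2((1-k^2)s+k^4-k^2+1)}{(k^2-1-s)L^2}.$$ $\omega(k)$ is a strictly increasing bijection from $(0,1)$ onto $(4\pi^2/L^2,\infty)$. The wave is $$\varphi_k(x)=\frac{a\,{\rm cn}(bx,k)}{\sqrt{1-q\,{\rm sn}^2(bx,k)}},$$ and $\varphi_\omega:=\varphi_k$ with $\omega(k)=\omega$. The subscript $e$ denotes the subspace of even functions. *)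

(* Defs.v *)
From HB Require Import structures.
From mathcomp Require Import all_boot all_order all_algebra.
From mathcomp Require Import all_classical all_reals all_analysis.
Set Implicit Arguments. Unset Strict Implicit. Unset Printing Implicit Defensive.
Import Order.TTheory GRing.Theory Num.Theory.
Import numFieldNormedType.Exports.
Local Open Scope classical_set_scope.
Local Open Scope ring_scope.

Section Defs.
Variable R : realType.
Local Notation leb := (@lebesgue_measure R).

Definition ellF (t k : R) : R :=
  let f := fun th : R => 1 / Num.sqrt (1 - k ^+ 2 * sin th ^+ 2) in
  if 0 <= t then \int[leb]_(th in `[0, t]) f th
  else - \int[leb]_(th in `[t, 0]) f th.

Definition ellK (k : R) : R := ellF (pi / 2) k.

Definition jam (u k : R) : R := xget 0 [set t | ellF t k = u].
Definition jsn (u k : R) : R := sin (jam u k).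
Definition jcn (u k : R) : R := cos (jam u k).

Definition s_ (k : R) : R := Num.sqrt (k ^+ 4 - k ^+ 2 + 1).
Definition q_ (k : R) : R := k ^+ 2 - 1 - s_ k.
Definition b_ (L k : R) : R := 4 * ellK k / L.
Definition a_ (L k : R) : R :=
  2 * Num.sqrt (Num.sqrt (ellK k ^+ 2 * (k ^+ 2 - 1 - s_ k)
                           * (- k ^+ 2 - 1 - s_ k) * L ^+ 2)) / L.
Definition omega_ (L k : R) : R :=
  (- 16 * ellK k ^+ 2 * ((1 - k ^+ 2) * s_ k + k ^+ 4 - k ^+ 2 + 1))
  / ((k ^+ 2 - 1 - s_ k) * L ^+ 2).
Definition cnoidal (L k : R) (x : R) : R :=
  a_ L k * jcn (b_ L k * x) k
  / Num.sqrt (1 - q_ k * jsn (b_ L k * x) k ^+ 2).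

Definition periodic (L : R) (f : R -> R) := forall x, f (x + L) = f x.
Definition evenf (f : R -> R) := forall x, f (- x) = f x.

Definition L2per (L : R) (f : R -> R) :=
  measurable_fun setT f /\ periodic L f /\
  (\int[leb]_(x in `[0%R, L]) ((f x) ^+ 2)%:E < +oo)%E.
Definition L2pe (L : R) (f : R -> R) := L2per L f /\ evenf f.

Definition nrm2 (L : R) (f : R -> R) : \bar R :=
  (\int[leb]_(x in `[0%R, L]) ((f x) ^+ 2)%:E)%E.

(* u ∈ H^2_{per,e}, with w a (weak, a.e.) second derivative of u:
   u is C^1, even, L-periodic, and u' is absolutely continuous with
   u'(b) - u'(a) = int_a^b w, where w ∈ L^2_per *)
Definition H2pe (L : R) (u w : R -> R) :=
  periodic L u /\ evenf u /\ L2per L w /\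
  exists du : R -> R, (forall x, is_derive x (1 : R) u (du x)) /\
    forall a b, a <= b -> du b - du a = \int[leb]_(x in `[a, b]) w x.

(** The operator  L_e = diag(-d^2 + ω - 5 φ^4, -d^2 + ω - φ^4)
    on H^2_{per,e} x H^2_{per,e} ⊂ L^2_{per,e} x L^2_{per,e}.
    For (u1,u2) in the domain with second derivatives (w1,w2),
    Lop1 and Lop2 give the two components of L_e (u1,u2). *)
Definition Lop1 (om : R) (phi : R -> R) (u w : R -> R) (x : R) : R :=
  - w x + (om - 5 * phi x ^+ 4) * u x.
Definition Lop2 (om : R) (phi : R -> R) (u w : R -> R) (x : R) : R :=
  - w x + (om - phi x ^+ 4) * u x.

(* (u1,u2) is in the kernel of L_e - λ (possibly zero) *)
Definition eigvec (L om : R) (phi : R -> R) (lam : R) (u1 u2 : R -> R) :=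
  exists w1 w2, H2pe L u1 w1 /\ H2pe L u2 w2 /\
    {ae leb, forall x, Lop1 om phi u1 w1 x = lam * u1 x} /\
    {ae leb, forall x, Lop2 om phi u2 w2 x = lam * u2 x}.

Definition nonzero2 (u1 u2 : R -> R) :=
  ~ (u1 = (fun _ => 0) /\ u2 = (fun _ => 0)).

Definition is_eigenvalue (L om : R) (phi : R -> R) (lam : R) :=
  exists u1 u2, eigvec L om phi lam u1 u2 /\ nonzero2 u1 u2.

Definition simple_eig_with (L om : R) (phi : R -> R) (lam : R) (v1 v2 : R -> R) :=
  eigvec L om phi lam v1 v2 /\ nonzero2 v1 v2 /\
  forall u1 u2, eigvec L om phi lam u1 u2 ->
    exists c : R, u1 = (fun x => c * v1 x) /\ u2 = (fun x => c * v2 x).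

Definition simple_eig (L om : R) (phi : R -> R) (lam : R) :=
  exists v1 v2, simple_eig_with L om phi lam v1 v2.

(* resolvent set: L_e - λ : D -> L^2_{per,e} x L^2_{per,e} is onto
   and has a bounded inverse *)
Definition resolvent (L om : R) (phi : R -> R) (lam : R) :=
  (forall g1 g2, L2pe L g1 -> L2pe L g2 ->
     exists u1 w1 u2 w2, H2pe L u1 w1 /\ H2pe L u2 w2 /\
       {ae leb, forall x, Lop1 om phi u1 w1 x - lam * u1 x = g1 x} /\
       {ae leb, forall x, Lop2 om phi u2 w2 x - lam * u2 x = g2 x}) /\
  exists C : R, forall u1 w1 u2 w2, H2pe L u1 w1 -> H2pe L u2 w2 ->
    (nrm2 L u1 + nrm2 L u2 <=
     C%:E * (nrm2 L (fun x => (Lop1 om phi u1 w1 x - lam * u1 x)%R)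
             + nrm2 L (fun x => (Lop2 om phi u2 w2 x - lam * u2 x)%R)))%E.

Definition spectrum (L om : R) (phi : R -> R) (lam : R) :=
  ~ resolvent L om phi lam.

End Defs.

(* Main.v *)
Require Import Defs.
From HB Require Import structures.
From mathcomp Require Import all_boot all_order all_algebra.
From mathcomp Require Import ring lra.
From mathcomp Require Import all_classical all_reals all_analysis.
From mathcomp Require Import measurable_realfun.
Import Order.TTheory GRing.Theory Num.Theory.
Import numFieldNormedType.Exports.
Set Implicit Arguments. Unset Strict Implicit. Unset Printing Implicit Defensive.
Local Open Scope classical_set_scope.
Local Open Scope ring_scope.

(** The wave phi is even about 0 and odd about L/4, so both potentials are even about 0 and about
    L/4, and even L-periodic solutions of (L_i - l) y = 0 are the multiples of the solution y_l
    with y_l(0) = 1, y_l'(0) = 0 for the values of l with y_l(L/4) = 0 or y_l'(L/4) = 0. Thus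
    everything reduces to two Sturm-Liouville problems on [0, L/4].
    For L_1, comparing y_l (l <= 0) with the odd kernel element phi' < 0 shows that y_l has at most
    one zero on (0, L/4] and that y_l'(L/4) < 0 if it has one. Hence each boundary condition admits
    at most one l <= 0, with y_l > 0 on [0, L/4); two values mu_0 < mu_1 <= - 2 a^4 - 2 om are
    found by the intermediate value theorem, the trial function phi^3 showing that y_l vanishes
    on [0, L/4] for l = - 2 a^4 - 2 om, where a = phi(0).
    For L_2, comparing y_l (l < 0) with the kernel element phi > 0 shows that y_l > 0 on [0, L/4],
    which leaves one negative eigenvalue nu; it satisfies nu > om - a^4 > mu_1, so that the three
    negative eigenvalues are distinct.
    Off the eigenvalues, L_i u - l u = g is solved by adding a multiple of y_l to a particular
    solution, and variation of constants bounds the inverse. Eigenvalues do not accumulate since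
    eigenfunctions of distinct eigenvalues are orthogonal while y_l depends continuously on l. *)

(** * Differential calculus on the line, Gronwall's inequality, uniqueness for linear equations *)

Section Calculus.
Variable R : realType.
Implicit Types (f g df dg : R -> R).

(** Elliptic functions enter only through [cnoidal_profile]: the spectral argument uses the equation
    of phi, om > 0, phi'(0) = 0, phi(L/4) = 0 and phi' < 0 on (0, L/4]. The cube is the power whose
    phi^7 terms cancel in L_1. The energy identity gives L_1 phi^3 = - 8 om phi^3 - (2 a^4 - 6 om)
    a^2 phi, and since a^4 > 3 om, replacing a^2 by the smaller phi^2 leaves (- 2 a^4 - 2 om) phi^3
    as an upper bound. An explicit bound on mu_1 is needed beyond its sign: for a diagonal operator
    simplicity fails where the two components share an eigenvalue, and om - a^4, the minimum of the
    potential of L_2, lies above - 2 a^4 - 2 om. The comparison for L_1 includes l = 0, so L_1 has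
    no even periodic kernel and the kernel of the full operator comes from phi alone. Domain
    functions have only an almost everywhere second derivative; adding a primitive of the source to
    u' leads back to classical equations, where uniqueness applies. *)

Definition derives f df := forall x, is_derive x (1 : R) f (df x).

Lemma derives_eq f df dg : derives f df -> df =1 dg -> derives f dg.
Proof. by move=> h e x; rewrite -e. Qed.

Lemma eq_derives f g df : derives f df -> f =1 g -> derives g df.
Proof. by move=> h /funext <-. Qed.

Lemma derives_unique f df dg : derives f df -> derives f dg -> df =1 dg.
Proof. by move=> h k x; have [_ <-] := h x; have [_ <-] := k x. Qed.

Lemma derives_cst (c : R) : derives (fun=> c) (fun=> 0).
Proof. move=> x; exact: is_derive_cst. Qed.

Lemma derives_id : derives id (fun=> 1).
Proof. move=> x; exact: is_derive_id. Qed.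

Lemma derivesD f g df dg : derives f df -> derives g dg ->
  derives (fun x => f x + g x) (fun x => df x + dg x).
Proof. move=> h k x; have := h x; have := k x => ? ?; exact: is_deriveD. Qed.

Lemma derivesN f df : derives f df -> derives (fun x => - f x) (fun x => - df x).
Proof. move=> h x; have := h x => ?; exact: is_deriveN. Qed.

Lemma derivesB f g df dg : derives f df -> derives g dg ->
  derives (fun x => f x - g x) (fun x => df x - dg x).
Proof. move=> h k; exact: (derivesD h (derivesN k)). Qed.

Lemma derivesM f g df dg : derives f df -> derives g dg ->
  derives (fun x => f x * g x) (fun x => df x * g x + f x * dg x).
Proof.
move=> h k x; have h1 := h x; have k1 := k x.
apply: (is_derive_eq (is_deriveM h1 k1)).
by rewrite addrC /GRing.scale /= mulrC.
Qed.

Lemma derivesZ (c : R) f df : derives f df ->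
  derives (fun x => c * f x) (fun x => c * df x).
Proof.
move=> h; apply: (derives_eq (derivesM (derives_cst c) h)) => x.
by rewrite mul0r add0r.
Qed.

Lemma derivesX f df n : derives f df ->
  derives (fun x => f x ^+ n) (fun x => n%:R * f x ^+ n.-1 * df x).
Proof. by move=> h x; have h1 := h x; have := is_deriveX n h1; rewrite exprfctE. Qed.

Lemma derives_comp f g df dg : derives f df -> derives g dg ->
  derives (fun x => f (g x)) (fun x => df (g x) * dg x).
Proof. move=> h k x; have h1 := h (g x); have k1 := k x; exact: is_derive1_comp. Qed.

Lemma derives_reflect f df (c : R) : derives f df ->
  derives (fun x => f (c - x)) (fun x => - df (c - x)).
Proof.
move=> h; apply: (derives_eq (derives_comp h (derivesB (derives_cst c) derives_id))) => x.
by rewrite sub0r mulrN1.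
Qed.

Lemma derives_opp f df : derives f df ->
  derives (fun x => f (- x)) (fun x => - df (- x)).
Proof.
move=> h; apply: (derives_eq (derives_comp h (derivesN derives_id))) => x.
by rewrite mulrN1.
Qed.

Lemma derives_translate f df (c : R) : derives f df ->
  derives (fun x => f (x + c)) (fun x => df (x + c)).
Proof.
move=> h; apply: (derives_eq (derives_comp h (derivesD derives_id (derives_cst c)))) => x.
by rewrite addr0 mulr1.
Qed.

Lemma derives_continuous f df : derives f df -> continuous f.
Proof.
by move=> h x; have [h1 _] := h x; apply/differentiable_continuous/derivable1_diffP.
Qed.

Lemma derives_MVT f df a b : derives f df -> a <= b ->
  exists2 c : R, a <= c <= b & f b - f a = df c * (b - a).
Proof.
move=> h ab; have [||c] := @MVT_segment R f df a b ab.
- by move=> x _; exact: h.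
- exact/continuous_subspaceT/(derives_continuous h).
- by rewrite in_itv /=; exists c.
Qed.

Lemma derives_nondecr f df a b : derives f df -> a <= b ->
  (forall x : R, a <= x <= b -> 0 <= df x) -> f a <= f b.
Proof.
move=> h ab d0; have [c cab e] := derives_MVT h ab.
by rewrite -subr_ge0 e mulr_ge0 ?subr_ge0 // d0.
Qed.

Lemma derives_incr f df a b : derives f df -> a < b ->
  (forall x : R, a < x < b -> 0 < df x) -> f a < f b.
Proof.
move=> h ab d0; have [||c] := @MVT R f df a b ab.
- by move=> x _; exact: h.
- exact/continuous_subspaceT/(derives_continuous h).
rewrite in_itv /= => cab e.
by rewrite -subr_gt0 e mulr_gt0 ?subr_gt0 // d0.
Qed.

Lemma derives_lip f df a b (M : R) : derives f df -> a <= b ->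
  (forall x : R, a <= x <= b -> `|df x| <= M) -> `|f b - f a| <= M * (b - a).
Proof.
move=> h ab d0; have [c cab e] := derives_MVT h ab.
by rewrite e normrM (ger0_norm (x := b - a)) ?subr_ge0 // ler_wpM2r ?subr_ge0 // d0.
Qed.

Lemma derives0_cst f x y : derives f (fun=> 0) -> f x = f y.
Proof. by move=> h; apply: is_derive_0_is_cst. Qed.

Lemma continuous_bounded f (a b : R) : continuous f ->
  exists2 M : R, 0 <= M & forall x : R, a <= x <= b -> `|f x| <= M.
Proof.
move=> cf; case: (leP a b) => ab; last first.
  by exists 0 => // x /andP[h1 h2]; have := le_lt_trans (le_trans h1 h2) ab; rewrite ltxx.
have [|c _ cP] := @EVT_max R (fun x => `|f x|) a b ab.
  by apply: continuous_subspaceT => x; apply: continuous_comp; [exact: cf|exact: norm_continuous].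
by exists `|f c| => // x xab; apply: cP; rewrite in_itv.
Qed.

(** One-sided Fermat rule; it gives the sign of the derivative at a first zero reached from positive
    values. *)
Lemma derives_min_right f df a b : derives f df -> a < b ->
  (forall x : R, a <= x < b -> f b <= f x) -> df b <= 0.
Proof.
move=> h ab fb; rewrite leNgt; apply/negP => d0.
(* Caratheodory's form f z - f b = g z (z - b) with g continuous at b: a positive slope would put f
   z below f b just left of b. *)
have /is_derive1_caratheodory [g [fE gC gE]] := h b.
have : \forall z \near b, 0 < g z.
  by apply: (cvgr_gt _ gC); rewrite gE.
case=> e /= e0 He.
pose z := Num.max a (b - e / 2).
have zb : z < b by rewrite /z gt_max ab /= ltrBlDr ltrDl divr_gt0.
have az : a <= z by rewrite /z le_max lexx.
have zb2 : b - e / 2 <= z by rewrite /z le_max lexx orbT.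
have gz : 0 < g z.
  apply: He => /=; rewrite ger0_norm ?subr_ge0 ?(ltW zb) //.
  by lra.
have := fb z; rewrite az zb => /(_ isT).
have := fE z; rewrite -subr_ge0 => -> .
by nra.
Qed.

(** The zero is the infimum of the points of [0, b] where f <= 0. Continuity excludes f > 0 there,
    and f < 0 there would give such points further left. *)
Lemma first_zero f (b : R) : continuous f -> 0 < f 0 -> 0 <= b -> f b <= 0 ->
  exists al : R, [/\ 0 < al <= b, f al = 0 & forall x : R, 0 <= x < al -> 0 < f x].
Proof.
move=> cf f0 b0 fb.
pose S := [set x | 0 <= x <= b /\ f x <= 0].
have Sb : S b by rewrite /S /= lexx b0.
have Slb : has_lbound S by exists 0 => x [/andP[]].
have Sinf : has_inf S by split=> //; exists b.
pose al := inf S.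
have al0 : 0 <= al by apply: lb_le_inf; [exists b|move=> x [/andP[]]].
have alb : al <= b by apply: ge_inf.
have pos x : 0 <= x < al -> 0 < f x.
  case/andP=> x0 xa; rewrite ltNge; apply/negP => fx.
  have : al <= x by apply: ge_inf => //; split=> //; rewrite x0 (le_trans (ltW xa)).
  by rewrite leNgt xa.
have fal : f al <= 0.
  rewrite leNgt; apply/negP => fa.
  have : \forall z \near al, 0 < f z by apply: (cvgr_gt _ (cf al)).
  case=> e /= e0 He.
  have [y Sy ye] := inf_adherent e0 Sinf.
  have aly : al <= y by apply: ge_inf.
  have [_] := Sy; apply/negP; rewrite -ltNge; apply: He => /=.
  rewrite distrC ger0_norm ?subr_ge0 //.
  by rewrite ltrBlDl.
have alp : 0 < al.
  by rewrite lt_neqAle al0 andbT; apply/eqP => e; move: fal; rewrite -e leNgt f0.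
exists al; split => //; first by rewrite alp.
apply/eqP; rewrite eq_le fal /= leNgt; apply/negP => fa.
have : \forall z \near al, f z < 0 by apply: (cvgr_lt _ (cf al)).
case=> e /= e0 He.
pose z := Num.max 0 (al - e / 2).
have z0 : 0 <= z by rewrite /z le_max lexx.
have za : z < al by rewrite /z gt_max alp /= ltrBlDr ltrDl divr_gt0.
have zb2 : al - e / 2 <= z by rewrite /z le_max lexx orbT.
have : f z < 0.
  apply: He => /=; rewrite ger0_norm ?subr_ge0 ?(ltW za) //.
  by lra.
by apply/negP; rewrite -leNgt ltW // pos // z0.
Qed.

Lemma continuous_IVT0 f (a b : R) : continuous f -> a <= b -> f a * f b <= 0 ->
  exists2 c : R, a <= c <= b & f c = 0.
Proof.
move=> cf ab fab.
have [||c] := @IVT R f a b 0 ab.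
- exact: continuous_subspaceT.
- rewrite ge_min le_max; case: (leP (f a) 0) => h1; case: (leP 0 (f b)) => h2 //=.
  + by case: (leP 0 (f a)) => //= h3; nra.
  + by case: (leP (f b) 0) => //= h3; nra.
  + by rewrite (ltW h1); nra.
  + by rewrite (ltW h1) (ltW h2).
- by rewrite in_itv /=; exists c.
Qed.

(* The energy e = u^2 + u'^2 satisfies e' <= (M+2) e + eps^2. *)
Lemma gronwall (u du Q F : R -> R) (X M eps : R) :
  derives u du -> derives du (fun x => Q x * u x + F x) ->
  0 <= M -> (forall x : R, 0 <= x <= X -> `|Q x| <= M) ->
  (forall x : R, 0 <= x <= X -> `|F x| <= eps) ->
  forall x : R, 0 <= x <= X ->
    u x ^+ 2 + du x ^+ 2 <=
    (u 0 ^+ 2 + du 0 ^+ 2 + eps ^+ 2 * x) * expR ((M + 2) * x).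
Proof.
move=> hu hdu M0 QM Feps x /andP[x0 xX].
pose K := M + 2.
pose E x := expR (- (K * x)).
have hE : derives E (fun x => E x * - K).
  have h := derives_comp (fun x => is_derive_expR x) (derivesZ (- K) derives_id).
  apply: (derives_eq (eq_derives h _)) => z; rewrite /E ?mulr1 ?mulNr //.
pose e x := u x ^+ 2 + du x ^+ 2.
(* Damped by E <= 1, the energy grows at rate at most eps^2, so f is nondecreasing. *)
pose f x := eps ^+ 2 * x - e x * E x.
have he := derivesD (derivesX 2 hu) (derivesX 2 hdu).
have hf := derivesB (derivesZ (eps ^+ 2) derives_id) (derivesM he hE).
have : f 0 <= f x.
  apply: (derives_nondecr hf) => // t /andP[t0 tx].
  have tX : 0 <= t <= X by rewrite t0 (le_trans tx).
  have := QM t tX; have := Feps t tX; rewrite !ler_norml => /andP[f1 f2] /andP[q1 q2].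
  have E1 : E t <= 1.
    by rewrite /E -expR0 ler_expR oppr_le0 mulr_ge0 // /K addr_ge0.
  have E0 : 0 <= E t by exact: expR_ge0.
  rewrite /= !expr1 mulr1.
  have F2 : F t ^+ 2 <= eps ^+ 2 by nra.
  have H : 2 * u t * du t + 2 * du t * (Q t * u t + F t) - K * e t <= eps ^+ 2.
    rewrite /K /e.
    have : 2 * (u t * du t) <= u t ^+ 2 + du t ^+ 2.
      by have := sqr_ge0 (u t - du t); rewrite !expr2; nra.
    have : 2 * (F t * du t) <= F t ^+ 2 + du t ^+ 2.
      by have := sqr_ge0 (F t - du t); rewrite !expr2; nra.
    have : 2 * (Q t * (u t * du t)) <= M * (u t ^+ 2 + du t ^+ 2).
      have := sqr_ge0 (u t - du t); have := sqr_ge0 (u t + du t).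
      rewrite !expr2; nra.
    have := sqr_ge0 (u t); have := sqr_ge0 (du t); rewrite !expr2; nra.
  rewrite -/(e t).
  have -> : eps ^+ 2 - ((2 * u t * du t + 2 * du t * (Q t * u t + F t)) * E t + e t * (E t * - K))
    = eps ^+ 2 - (2 * u t * du t + 2 * du t * (Q t * u t + F t) - K * e t) * E t by ring.
  have := sqr_ge0 eps; nra.
rewrite /f mulr0 /E mulr0 oppr0 expR0 mulr1 sub0r expRN -/K.
have P := expR_gt0 (K * x).
rewrite lerNl opprB => h.
have : e x / expR (K * x) <= e 0 + eps ^+ 2 * x by rewrite -lerBlDr.
by rewrite ler_pdivrMr.
Qed.

Lemma linear_ode_unique (u du Q : R -> R) : continuous Q ->
  derives u du -> derives du (fun x => Q x * u x) ->
  u 0 = 0 -> du 0 = 0 -> forall x, u x = 0.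
Proof.
have main (v dv P : R -> R) : continuous P ->
    derives v dv -> derives dv (fun x => P x * v x) ->
    v 0 = 0 -> dv 0 = 0 -> forall x : R, 0 <= x -> v x = 0.
  move=> cP hv hdv v0 dv0 x x0.
  have [M M0 PM] := continuous_bounded 0 x cP.
  have hdv' : derives dv (fun x => P x * v x + (fun=> 0) x).
    by apply: (derives_eq hdv) => z; rewrite addr0.
  have F0 (y : R) : 0 <= y <= x -> `|(fun=> (0 : R)) y| <= 0 by rewrite normr0.
  have xx : 0 <= x <= x by rewrite x0 lexx.
  have := gronwall hv hdv' M0 PM F0 xx.
  rewrite v0 dv0 !expr0n /= !addr0 !mul0r => H.
  apply/eqP; rewrite -sqrf_eq0 eq_le sqr_ge0 andbT.
  by move: H; rewrite addr0 mul0r; have := sqr_ge0 (dv x); lra.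
move=> cQ hu hdu u0 du0 x; case: (leP 0 x) => x0; first exact: (main u du Q).
have -> : u x = (fun y => u (- y)) (- x) by rewrite opprK.
apply: (main (fun y => u (- y)) (fun y => - du (- y)) (fun y => Q (- y))).
- by move=> y; apply: (@continuous_comp _ _ _ -%R Q); [exact: opp_continuous|exact: cQ].
- exact: derives_opp.
- by apply: (derives_eq (derivesN (derives_opp hdu))) => y; rewrite opprK.
- by rewrite oppr0.
- by rewrite !oppr0 du0 oppr0.
- by rewrite oppr_ge0 ltW.
Qed.

End Calculus.

(** * Primitives of locally integrable functions and their symmetries *)

Section LebesguePrimitive.
Variable R : realType.
Local Notation leb := (@lebesgue_measure R).
Implicit Types g : R -> R.

(** By uniqueness of Lebesgue measure it suffices to treat half-open intervals; the reflection swaps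
    their open and closed ends, which does not affect the length. *)
Lemma lebesgue_measure_reflect (c : R) (A : set R) : measurable A ->
  leb ((fun x => c - x : measurableTypeR R) @^-1` A) = leb A.
Proof.
have mr : measurable_fun setT (fun x : R => c - x : measurableTypeR R).
  by apply: measurable_funB.
move=> mA; apply/esym.
apply: (@lebesgue_measure_unique R (pushforward leb (fun x => c - x : measurableTypeR R))) => // _ [[a b]] _ <-.
rewrite /= /pushforward.
have -> : (fun x => c - x : measurableTypeR R) @^-1` `]a, b] = `[c - b, c - a[%classic.
  by apply/seteqP; split => x /=; rewrite !in_itv /= => /andP[h1 h2]; apply/andP; split; lra.
rewrite !lebesgue_measure_itv /= !lte_fin.
have -> : (c - b < c - a) = (a < b) by rewrite ltrD2l ltrN2.
by case: ifP => // _; rewrite -!EFinB; congr (_%:E); ring.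
Qed.

Lemma lebesgue_measure_translate (c : R) (A : set R) : measurable A ->
  leb ((fun x => x + c : measurableTypeR R) @^-1` A) = leb A.
Proof.
have mr : measurable_fun setT (fun x : R => x + c : measurableTypeR R).
  by apply: measurable_funD.
move=> mA; apply/esym.
apply: (@lebesgue_measure_unique R (pushforward leb (fun x => x + c : measurableTypeR R))) => // _ [[a b]] _ <-.
rewrite /= /pushforward.
have -> : (fun x => x + c : measurableTypeR R) @^-1` `]a, b] = `]a - c, b - c]%classic.
  by apply/seteqP; split => x /=; rewrite !in_itv /= => /andP[h1 h2]; apply/andP; split; lra.
rewrite !lebesgue_measure_itv /= !lte_fin.
have -> : (a - c < b - c) = (a < b) by rewrite ltrD2r.
by case: ifP => // _; rewrite -!EFinB; congr (_%:E); ring.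
Qed.

Definition locint g := forall a b : R, leb.-integrable `[a, b] (EFin \o g).

Lemma continuous_locint g : continuous g -> locint g.
Proof.
move=> cg a b; apply: continuous_compact_integrable; first exact: segment_compact.
exact: continuous_subspaceT.
Qed.

Lemma locintD g1 g2 : locint g1 -> locint g2 -> locint (fun x => g1 x + g2 x).
Proof.
move=> h1 h2 a b; have := integrableD _ (h1 a b) (h2 a b).
move=> /(_ (measurable_itv _)); exact: eq_integrable.
Qed.

Lemma locintZ g (c : R) : locint g -> locint (fun x => c * g x).
Proof.
move=> h a b; have := integrableZl _ c (h a b).
move=> /(_ (measurable_itv _)); exact: eq_integrable.
Qed.

Lemma locintN g : locint g -> locint (fun x => - g x).
Proof.
by move=> h; have := locintZ (-1) h; under eq_fun do rewrite mulN1r.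
Qed.

Lemma locint_norm g : locint g -> locint (fun x => `|g x|).
Proof.
move=> h a b; have := integrable_abse (h a b); exact: eq_integrable.
Qed.

Lemma Rintegral_cat g (a b c : R) : locint g -> a <= b -> b <= c ->
  \int[leb]_(x in `[a, c]) g x =
  \int[leb]_(x in `[a, b]) g x + \int[leb]_(x in `[b, c]) g x.
Proof.
move=> h ab bc; apply/eqP; rewrite addrC -subr_eq; apply/eqP.
rewrite (Rintegral_itvB (h a c)) ?bnd_simp // Rintegral_itv_obnd_cbnd //.
by apply: integrableS (h b c) => //; apply: subset_itvr; rewrite bnd_simp.
Qed.

(** The sign convention is that of [ellF], so that [ellF] is itself the [pint] of its integrand. *)
Definition pint g (x : R) : R :=
  if 0 <= x then \int[leb]_(t in `[0, x]) g t else - \int[leb]_(t in `[x, 0]) g t.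

Lemma pint0 g : pint g 0 = 0.
Proof. by rewrite /pint lexx set_itv1 Rintegral_set1. Qed.

Lemma Rintegral_pint g (a b : R) : locint g -> a <= b ->
  \int[leb]_(x in `[a, b]) g x = pint g b - pint g a.
Proof.
move=> h ab; rewrite /pint; case: (leP 0 a) => a0; case: (leP 0 b) => b0.
- by rewrite (Rintegral_cat h a0 ab); ring.
- by have := le_lt_trans (le_trans a0 ab) b0; rewrite ltxx.
- by rewrite (Rintegral_cat h (ltW a0) b0); ring.
- by rewrite (Rintegral_cat h ab (ltW b0)); ring.
Qed.

Lemma pint_unique g (F : R -> R) :
  (forall a b : R, a <= b -> F b - F a = \int[leb]_(x in `[a, b]) g x) ->
  forall x, F x = F 0 + pint g x.
Proof.
move=> h x; rewrite /pint; case: (leP 0 x) => x0.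
  by rewrite -h //; ring.
by rewrite -h ?ltW //; ring.
Qed.

Lemma derives_pint g : continuous g -> derives (pint g) g.
Proof.
move=> cg x; have h := continuous_locint cg.
(* The fundamental theorem asks for a base point to the left of x; the primitive based at x - 1
   differs from [pint g] by the constant [pint g a]. *)
pose a := x - 1.
have ax : a < x by rewrite /a; lra.
have xu : x < x + 1 by lra.
have [d1 d2] := continuous_FTC1_closed xu (h a (x + 1)) ax (cg x).
have d : is_derive x 1 (fun z => \int[leb]_(t in `[a, z]) g t) (g x).
  by apply: DeriveDef; [exact: d1|rewrite -derive1E; exact: d2].
have := is_deriveD d (is_derive_cst (pint g a) x 1); rewrite addr0.
move: d => _; move: d1 d2 => _ _.
apply: near_eq_is_derive.
exists 1 => //= z /=; rewrite ltr_norml => /andP[_ z1].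
have az : a <= z by rewrite /a; lra.
by rewrite !fctE (Rintegral_pint h az) subrK.
Qed.

Lemma pint_continuous g : locint g -> continuous (pint g).
Proof.
move=> h; suff H (x : R) : {for x, continuous (pint g)} by exact: H.
have ab : x - 1 <= x + 1 by lra.
have ab' : x - 1 < x + 1 by lra.
have := parameterized_integral_continuous ab (h (x - 1) (x + 1)).
move=> /(continuous_within_itvP _ ab')[H _ _].
have xin : x \in `](x - 1), (x + 1)[ by rewrite in_itv /=; apply/andP; split; lra.
have {}H := H x xin.
have {}H : {for x, continuous (fun z => parameterized_integral leb (x - 1) z g + pint g (x - 1))}.
  by apply: cvgD; [exact: H|exact: cvg_cst].
have E (z : R) : x - 1 <= z -> parameterized_integral leb (x - 1) z g + pint g (x - 1) = pint g z.
  by move=> az; rewrite /parameterized_integral (Rintegral_pint h az) subrK.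
have x1x : x - 1 <= x by lra.
move: H; rewrite /prop_for /continuous_at /= (E x x1x) => H.
apply: cvg_trans H; apply: near_eq_cvg.
exists 1 => //= z /=; rewrite ltr_norml => /andP[_ z1].
by rewrite E // ltW // ltrBlDr -ltrBlDl.
Qed.

Lemma pintD g1 g2 x : locint g1 -> locint g2 ->
  pint (fun t => g1 t + g2 t) x = pint g1 x + pint g2 x.
Proof.
move=> h1 h2; rewrite /pint; case: ifP => _; rewrite RintegralD //.
by ring.
Qed.

Lemma pintZ g (c : R) x : locint g -> pint (fun t => c * g t) x = c * pint g x.
Proof.
by move=> h; rewrite /pint; case: ifP => _; rewrite RintegralZl // mulrN.
Qed.

Lemma pint_ae g1 g2 x : measurable_fun setT g1 -> measurable_fun setT g2 ->
  {ae leb, forall t, g1 t = g2 t} -> pint g1 x = pint g2 x.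
Proof.
move=> m1 m2 e.
have E (a b : R) : \int[leb]_(t in `[a, b]) g1 t = \int[leb]_(t in `[a, b]) g2 t.
  rewrite /Rintegral; congr fine; apply: ae_eq_integral => //.
  - by apply/measurable_EFinP; apply: measurable_funTS.
  - by apply/measurable_EFinP; apply: measurable_funTS.
  - case: e => A [mA A0 sA]; exists A; split=> // t /= nt.
    by apply: sA => /= e; apply: nt => _; rewrite e.
by rewrite /pint !E.
Qed.

Lemma ge0_integral_reflect (f : R -> \bar R) (a b c : R) :
  measurable_fun setT f -> (forall x, 0 <= f x)%E ->
  (\int[leb]_(x in `[a, b]) f (c - x)%R = \int[leb]_(x in `[(c - b)%R, (c - a)%R]) f x)%E.
Proof.
move=> mf f0.
have mr : measurable_fun setT (fun x : R => c - x : measurableTypeR R).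
  by apply: measurable_funB.
have S : `[a, b]%classic = (fun x => c - x : measurableTypeR R) @^-1` `[c - b, c - a].
  by apply/seteqP; split => x /=; rewrite !in_itv /= => /andP[h1 h2]; apply/andP; split; lra.
rewrite S -ge0_integral_pushforward //; last exact: measurable_funTS.
by apply: eq_measure_integral => A mA _; exact: lebesgue_measure_reflect.
Qed.

Lemma ge0_integral_translate (f : R -> \bar R) (a b c : R) :
  measurable_fun setT f -> (forall x, 0 <= f x)%E ->
  (\int[leb]_(x in `[a, b]) f (x + c)%R = \int[leb]_(x in `[(a + c)%R, (b + c)%R]) f x)%E.
Proof.
move=> mf f0.
have mr : measurable_fun setT (fun x : R => x + c : measurableTypeR R).
  by apply: measurable_funD.
have S : `[a, b]%classic = (fun x => x + c : measurableTypeR R) @^-1` `[a + c, b + c].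
  by apply/seteqP; split => x /=; rewrite !in_itv /= => /andP[h1 h2]; apply/andP; split; lra.
rewrite S -ge0_integral_pushforward //; last exact: measurable_funTS.
by apply: eq_measure_integral => A mA _; exact: lebesgue_measure_translate.
Qed.

Lemma Rintegral_reflect g (a b c : R) : measurable_fun setT g ->
  (forall x, g (c - x) = g x) ->
  \int[leb]_(x in `[a, b]) g x = \int[leb]_(x in `[c - b, c - a]) g x.
Proof.
move=> mg gc; rewrite /Rintegral; congr fine.
have mg' : measurable_fun setT (EFin \o g) by exact/measurable_EFinP.
(* The change of variables is available for nonnegative functions, hence the split into positive and
   negative parts. *)
rewrite integralE [RHS]integralE; congr (_ - _)%E.
  rewrite -(ge0_integral_reflect a b c (measurable_funepos mg')) //.
  by apply: eq_integral => x _; rewrite !funeposE /= gc.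
rewrite -(ge0_integral_reflect a b c (measurable_funeneg mg')) //.
by apply: eq_integral => x _; rewrite !funenegE /= gc.
Qed.

Lemma pint_reflect g (c : R) x : locint g -> measurable_fun setT g ->
  (forall x, g (c - x) = g x) -> pint g (c - x) = pint g c - pint g x.
Proof.
move=> lg mg gc.
have H (a b : R) : a <= b -> pint g b - pint g a = pint g (c - a) - pint g (c - b).
  move=> ab; rewrite -!Rintegral_pint ?lerB //.
  exact: Rintegral_reflect.
case: (leP 0 x) => x0.
  by have := H _ _ x0; rewrite subr0 pint0; lra.
by have := H _ _ (ltW x0); rewrite subr0 pint0; lra.
Qed.

Lemma le_pint g (x y : R) : locint g -> x <= y -> (forall t, 0 <= g t) ->
  pint g x <= pint g y.
Proof.
move=> lg xy g0; rewrite -subr_ge0 -Rintegral_pint //; exact: Rintegral_ge0.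
Qed.

Lemma normr_pint g (x y : R) : locint g -> 0 <= x <= y ->
  `|pint g x| <= pint (fun t => `|g t|) y.
Proof.
move=> lg /andP[x0 xy]; apply: (@le_trans _ _ (pint (fun t => `|g t|) x)).
  by rewrite /pint x0; apply: le_normr_Rintegral.
by apply: le_pint => //; exact: locint_norm.
Qed.

End LebesguePrimitive.

(** * Existence for linear second-order equations by Picard iteration *)

Section LinearODE.
Variable R : realType.
Implicit Types f Q F : R -> R.

Lemma half_power_small (C e : R) : 0 < e -> exists n, C / 2 ^+ n < e.
Proof.
move=> e0; pose n := Num.bound `|C / e|; exists n.
have p2 : 0 < (2 : R) ^+ n by apply: exprn_gt0.
rewrite ltr_pdivrMr // -ltr_pdivrMl // mulrC.
apply: le_lt_trans (ler_norm _) _; apply: (@lt_le_trans _ _ n%:R).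
  by exact: (archi_boundP (normr_ge0 _)).
by rewrite -natrX ler_nat ltnW // ltn_expl.
Qed.

Lemma half_power_le0 (x C : R) : (forall n, x <= C / 2 ^+ n) -> x <= 0.
Proof.
move=> h; rewrite leNgt; apply/negP => x0.
by have [n] := half_power_small C x0; rewrite ltNge h.
Qed.

(** Nested intervals: 2B / 2^n is the tail of the geometric series, so [a n] minus it increases,
    [a n] plus it decreases, and the supremum of the lower ends is the limit. *)
Lemma geometric_limit (a : nat -> R) (B : R) :
  (forall n, `|a n.+1 - a n| <= B / 2 ^+ n) ->
  exists l : R, forall n, `|l - a n| <= 2 * B / 2 ^+ n.
Proof.
move=> h; pose v n := a n - 2 * B / 2 ^+ n; pose w n := a n + 2 * B / 2 ^+ n.
have B0 : 0 <= B by have := h 0%N; rewrite expr0 divr1; apply: le_trans.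
have E n : 2 * B / 2 ^+ n = 2 * (B / 2 ^+ n) by rewrite mulrA.
have ES n : 2 * B / 2 ^+ n.+1 = B / 2 ^+ n.
  by rewrite exprS invfM mulrACA divff ?mul1r // pnatr_eq0.
have vS n : v n <= v n.+1.
  by have := h n; rewrite ler_norml /v ES E => /andP[]; lra.
have wS n : w n.+1 <= w n.
  by have := h n; rewrite ler_norml /w ES E => /andP[]; lra.
have vm m n : (m <= n)%N -> v m <= v n.
  by move=> mn; apply: (@homo_leq _ v <=%O) => //; exact: le_trans.
have wm m n : (m <= n)%N -> w n <= w m.
  by move=> mn; apply: (@homo_leq _ w (fun x y => y <= x)) => // x y z ? /le_trans; apply.
have vw n : v n <= w n.
  have : 0 <= 2 * B / 2 ^+ n by rewrite divr_ge0 ?mulr_ge0 // exprn_ge0.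
  by rewrite /v /w; lra.
have vw' m n : v m <= w n.
  apply: (le_trans (vm m (maxn m n) (leq_maxl _ _))).
  by apply: (le_trans (vw _)); apply: wm; exact: leq_maxr.
exists (sup (range v)) => n.
have hs : has_sup (range v).
  by split; [exists (v 0%N), 0%N|exists (w 0%N) => _ [m _ <-]].
have h1 : v n <= sup (range v) by apply: sup_upper_bound => //; exists n.
have h2 : sup (range v) <= w n by apply: ge_sup => [|_ [m _ <-]//]; exists (v 0%N), 0%N.
by rewrite ler_norml; move: h1 h2; rewrite /v /w; lra.
Qed.

Lemma pint_opp f x : continuous f -> pint f (- x) = - pint (fun t => f (- t)) x.
Proof.
move=> cf.
have cf' : continuous (fun t => f (- t)).
  by move=> y; apply: (@continuous_comp _ _ _ -%R f); [exact: opp_continuous|exact: cf].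
have h1 := derives_opp (derives_pint cf).
have h2 := derivesD h1 (derives_pint cf').
have {}h2 : derives (fun x => pint f (- x) + pint (fun t => f (- t)) x) (fun=> 0).
  by apply: (derives_eq h2) => z; rewrite addNr.
have := derives0_cst x 0 h2; rewrite oppr0 !pint0 addr0 => /eqP.
by rewrite addr_eq0 => /eqP.
Qed.

(** Integration gains a factor 1/lam in the norm weighted by e^(lam |x|): adding or subtracting the
    primitive from (C/lam) e^(lam x) leaves a nondecreasing function on the positive side. *)
Lemma pint_expR_bound f (C lam X : R) : continuous f -> 0 < lam -> 0 <= C ->
  (forall t : R, `|t| <= X -> `|f t| <= C * expR (lam * `|t|)) ->
  forall x : R, `|x| <= X -> `|pint f x| <= C / lam * expR (lam * `|x|).
Proof.
move=> cf l0 C0 fb.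
have main (g : R -> R) : continuous g -> (forall t : R, `|t| <= X -> `|g t| <= C * expR (lam * `|t|)) ->
    forall x : R, 0 <= x -> x <= X -> `|pint g x| <= C / lam * expR (lam * x).
  move=> cg gb x x0 xX.
  have hE := derives_comp (fun x => is_derive_expR x) (derivesZ lam (@derives_id R)).
  have {}hE := derivesZ (C / lam) hE.
  have Cl : 0 <= C / lam by rewrite divr_ge0 // ltW.
  have H (t : R) : 0 <= t <= x -> - (C * expR (lam * t)) <= g t <= C * expR (lam * t).
    move=> /andP[t0 tx]; have := gb t; rewrite (ger0_norm t0) ler_norml; apply.
    exact: le_trans xX.
  have K t : C / lam * (expR (lam * t) * (lam * 1)) = C * expR (lam * t).
    by rewrite mulr1 [_ * lam]mulrC mulrA divfK ?gt_eqF.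
  have A1 := derives_nondecr (derivesB hE (derives_pint cg)) x0.
  have A2 := derives_nondecr (derivesD hE (derives_pint cg)) x0.
  rewrite !pint0 mulr0 expR0 in A1 A2.
  have {}A1 : C / lam * 1 - 0 <= C / lam * expR (lam * x) - pint g x.
    by apply: A1 => t /H /andP[? ?]; rewrite K subr_ge0.
  have {}A2 : C / lam * 1 + 0 <= C / lam * expR (lam * x) + pint g x.
    by apply: A2 => t /H /andP[? ?]; rewrite K; lra.
  by rewrite ler_norml; apply/andP; split; lra.
move=> x xX; case: (leP 0 x) => x0.
  by rewrite (ger0_norm x0) in xX *; exact: main.
rewrite (ltr0_norm x0) in xX *.
have -> : pint f x = - pint (fun t => f (- t)) (- x) by rewrite -pint_opp // opprK.
rewrite normrN; apply: main => //; last by rewrite oppr_ge0 ltW.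
- by move=> y; apply: (@continuous_comp _ _ _ -%R f); [exact: opp_continuous|exact: cf].
- by move=> t tX; have := fb (- t); rewrite !normrN; exact.
Qed.

Lemma continuousM_fun f g : continuous f -> continuous g -> continuous (fun x => f x * g x).
Proof. by move=> cf cg x; apply: cvgM; [exact: cf|exact: cg]. Qed.

Lemma continuousD_fun f g : continuous f -> continuous g -> continuous (fun x => f x + g x).
Proof. by move=> cf cg x; apply: cvgD; [exact: cf|exact: cg]. Qed.

Lemma continuousB_fun f g : continuous f -> continuous g -> continuous (fun x => f x - g x).
Proof. by move=> cf cg x; apply: cvgB; [exact: cf|exact: cg]. Qed.

Lemma pint2_derives f : continuous f -> derives (pint (pint f)) (pint f).
Proof. by move=> cf; apply/derives_pint/derives_continuous/derives_pint. Qed.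

Lemma pint2_continuous f : continuous f -> continuous (pint (pint f)).
Proof. by move=> /pint2_derives/derives_continuous. Qed.

Lemma bound_abs f (X : R) : continuous f ->
  exists2 M : R, 0 <= M & forall x : R, `|x| <= X -> `|f x| <= M.
Proof.
move=> cf; have [M M0 H] := continuous_bounded (- X) X cf.
by exists M => // x; rewrite ler_norml => /H.
Qed.

Lemma pint2_expR_bound f (C lam X : R) : continuous f -> 0 < lam -> 0 <= C ->
  (forall t : R, `|t| <= X -> `|f t| <= C * expR (lam * `|t|)) ->
  forall x : R, `|x| <= X -> `|pint (pint f) x| <= C / lam ^+ 2 * expR (lam * `|x|).
Proof.
move=> cf l0 C0 fb.
have -> : C / lam ^+ 2 = C / lam / lam by rewrite expr2 invfM mulrA.
apply: pint_expR_bound => //.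
- exact/derives_continuous/derives_pint.
- by rewrite divr_ge0 // ltW.
- exact: pint_expR_bound.
Qed.

Lemma pintB f g x : locint f -> locint g ->
  pint (fun t => f t - g t) x = pint f x - pint g x.
Proof.
move=> lf lg; have := pintD x lf (locintZ (-1) lg); rewrite pintZ // mulN1r => <-.
by congr (pint _ x); apply/funext => t; rewrite mulN1r.
Qed.

Lemma pint2B f g x : continuous f -> continuous g ->
  pint (pint (fun t => f t - g t)) x = pint (pint f) x - pint (pint g) x.
Proof.
move=> cf cg.
have L h : continuous h -> locint (pint h).
  by move=> ch; apply/continuous_locint/derives_continuous/derives_pint.
rewrite -pintB; [|exact: L|exact: L].
by congr (pint _ x); apply/funext => t; rewrite pintB //; exact: continuous_locint.
Qed.

Section Picard.
Variables (Q d0 : R -> R).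
Hypotheses (cQ : continuous Q) (cd0 : continuous d0).

Fixpoint picard n : R -> R :=
  if n is m.+1 then fun x => d0 x + pint (pint (fun t => Q t * picard m t)) x else d0.

Lemma picardS n x :
  picard n.+1 x = d0 x + pint (pint (fun t => Q t * picard n t)) x.
Proof. by []. Qed.

Lemma picard_continuous n : continuous (picard n).
Proof.
elim: n => //= n IH; apply: continuousD_fun => //.
by apply: pint2_continuous; exact: continuousM_fun.
Qed.

(* The weight e^(lam |x|) with lam^2 >= 2M makes the iteration a contraction of ratio 1/2. *)
Lemma picard_step (X : R) : exists B : R, forall x : R, `|x| <= X ->
  forall n, `|picard n.+1 x - picard n x| <= B / 2 ^+ n.
Proof.
have [M M0 HM] := bound_abs X cQ.
have [A A0 HA] : exists2 A : R, 0 <= A & forall x : R, `|x| <= X -> `|picard 1 x - picard 0 x| <= A.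
  by apply: bound_abs; apply: continuousB_fun; exact: picard_continuous.
pose lam := 2 * M + 1.
have l0 : 0 < lam by rewrite /lam; lra.
have lM : M / lam ^+ 2 <= 1 / 2.
  by rewrite ler_pdivrMr ?exprn_gt0 // /lam expr2; nra.
have step n : forall x : R, `|x| <= X ->
    `|picard n.+1 x - picard n x| <= A / 2 ^+ n * expR (lam * `|x|).
  elim: n => [|n IH] x xX.
    rewrite expr0 divr1; apply: (le_trans (HA x xX)).
    by rewrite ler_peMr // -expR0 ler_expR mulr_ge0 // ltW.
  pose f t := Q t * (picard n.+1 t - picard n t).
  have cf : continuous f.
    by apply: continuousM_fun => //; apply: continuousB_fun; exact: picard_continuous.
  have cn k : continuous (fun t => Q t * picard k t).
    by apply: continuousM_fun => //; exact: picard_continuous.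
  have E : picard n.+2 x - picard n.+1 x = pint (pint f) x.
    have -> : picard n.+2 x - picard n.+1 x =
        pint (pint (fun t => Q t * picard n.+1 t)) x - pint (pint (fun t => Q t * picard n t)) x.
      by rewrite (picardS n.+1 x) (picardS n x) opprD addrACA subrr add0r.
    rewrite -pint2B; [|exact: cn|exact: cn].
    by congr (pint (pint _) x); apply/funext => t; rewrite /f mulrBr.
  rewrite E.
  have C0 : 0 <= M * (A / 2 ^+ n) by rewrite !mulr_ge0 // invr_ge0 exprn_ge0.
  have fb (t : R) : `|t| <= X -> `|f t| <= M * (A / 2 ^+ n) * expR (lam * `|t|).
    move=> tX; rewrite /f normrM -mulrA; apply: ler_pM => //; [exact: HM|exact: IH].
  apply: (le_trans (pint2_expR_bound cf l0 C0 fb xX)).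
  rewrite ler_wpM2r ?expR_ge0 // mulrAC.
  have -> : A / 2 ^+ n.+1 = 1 / 2 * (A / 2 ^+ n).
    by rewrite exprS invfM mulrCA mul1r.
  by rewrite ler_wpM2r // divr_ge0 // exprn_ge0.
exists (A * expR (lam * X)) => x xX n.
apply: (le_trans (step n x xX)); rewrite mulrAC ler_wpM2r ?invr_ge0 ?exprn_ge0 //.
by rewrite ler_wpM2l // ler_expR ler_wpM2l // ltW.
Qed.

(** The limit is chosen pointwise. Limits being unique, the uniform rate on each [-X, X] carries
    over to it, which gives continuity and the passage to the limit under the double integral. *)
Lemma picard_fixpoint : exists u : R -> R, continuous u /\
  forall x : R, u x = d0 x + pint (pint (fun t => Q t * u t)) x.
Proof.
have /choice [u Hu] : forall x : R, exists l, exists B : R, forall n, `|l - picard n x| <= B / 2 ^+ n.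
  move=> x; have [B HB] := picard_step `|x|.
  have [l Hl] := geometric_limit (HB x (lexx _)).
  by exists l, (2 * B).
have unif (X : R) : exists2 B : R, 0 <= B & forall x : R, `|x| <= X -> forall n, `|u x - picard n x| <= B / 2 ^+ n.
  have [B HB] := picard_step X; exists `|2 * B| => // x xX n.
  have [l Hl] := geometric_limit (HB x xX); have [B' HB'] := Hu x.
  suff <- : l = u x.
    by apply: (le_trans (Hl n)); rewrite ler_wpM2r ?invr_ge0 ?exprn_ge0 // ler_norm.
  apply/eqP; rewrite -subr_eq0 -normr_eq0 eq_le normr_ge0 andbT.
  apply: (@half_power_le0 _ (2 * B + B')) => m.
  rewrite mulrDl; apply: le_trans (lerD (Hl m) (HB' m)).
  by rewrite [in leRHS](distrC (u x)); exact: ler_distD.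
have cu : continuous u.
  suff H (x : R) : {for x, continuous u} by exact: H.
  apply/cvgrPdist_lt => e e0.
  have [B B0 HB] := unif (`|x| + 1).
  have e3 : 0 < e / 3 by lra.
  have [n Hn] := half_power_small B e3.
  have := @picard_continuous n x.
  move/cvgrPdist_lt => /(_ _ e3)[d /= d0' Hd].
  exists (Num.min 1 d) => /=; first by rewrite lt_min ltr01.
  move=> t /=; rewrite lt_min => /andP[t1 td].
  have tX : `|t| <= `|x| + 1.
    by rewrite -lerBlDl; apply: le_trans (ltW t1); rewrite distrC lerB_dist.
  have xX : `|x| <= `|x| + 1 by lra.
  have h1 := HB x xX n; have h2 := HB t tX n; have h3 := Hd t td.
  have := ler_distD (picard n x) (u x) (u t).
  have := ler_distD (picard n t) (picard n x) (u t).
  rewrite (distrC (picard n t) (u t)); lra.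
exists u; split=> // x.
have [B B0 HB] := unif `|x|; have [M M0 HM] := bound_abs `|x| cQ.
apply/eqP; rewrite -subr_eq0 -normr_eq0 eq_le normr_ge0 andbT.
apply: (@half_power_le0 _ (B + M * B * expR `|x|)) => n.
have cQu : continuous (fun t => Q t * u t) by exact: continuousM_fun.
have cQn : continuous (fun t => Q t * picard n t).
  by apply: continuousM_fun => //; exact: picard_continuous.
(* The defect of u in the fixed-point equation is u - u_(n+1) plus the double primitive of Q (u_n -
   u); both are O(2^-n). *)
pose f t := Q t * picard n t - Q t * u t.
have cf : continuous f by exact: continuousB_fun.
have E : u x - (d0 x + pint (pint (fun t => Q t * u t)) x) =
    (u x - picard n.+1 x) + pint (pint f) x.
  rewrite /f pint2B // picardS.
  move: (pint (pint (fun t => Q t * picard n t)) x) (pint (pint (fun t => Q t * u t)) x) => p q.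
  ring.
rewrite E; apply: (le_trans (ler_normD _ _)); rewrite mulrDl; apply: lerD.
  apply: (le_trans (HB x (lexx _) n.+1)); rewrite ler_wpM2l //.
  by rewrite lef_pV2 ?posrE ?exprn_gt0 // exprS ler_peMl ?exprn_ge0 // ler1n.
have C0 : 0 <= M * B / 2 ^+ n by rewrite !mulr_ge0 // invr_ge0 exprn_ge0.
have fb (t : R) : `|t| <= `|x| -> `|f t| <= M * B / 2 ^+ n * expR (1 * `|t|).
  move=> tX; rewrite /f -mulrBr normrM.
  apply: (@le_trans _ _ (M * B / 2 ^+ n)).
    by rewrite -mulrA; apply: ler_pM => //; [exact: HM|rewrite distrC; exact: HB].
  by rewrite mul1r ler_peMr // -expR0 ler_expR.
have := pint2_expR_bound cf ltr01 C0 fb (lexx _).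
by rewrite expr1n divr1 mul1r mulrAC.
Qed.

End Picard.

Lemma linear_ode_exists Q F (c0 c1 : R) : continuous Q -> continuous F ->
  exists u du : R -> R, [/\ derives u du, derives du (fun x => Q x * u x + F x),
    u 0 = c0 & du 0 = c1].
Proof.
move=> cQ cF; pose d0 x := c0 + c1 * x + pint (pint F) x.
have hd0 : derives d0 (fun x => c1 + pint F x).
  apply: (derives_eq (derivesD (derivesD (derives_cst c0) (derivesZ c1 (@derives_id R))) (pint2_derives cF))).
  by move=> x; rewrite add0r mulr1.
have [u [cu ue]] := picard_fixpoint cQ (derives_continuous hd0).
have cQu : continuous (fun t => Q t * u t) by exact: continuousM_fun.
exists u, (fun x => c1 + pint F x + pint (fun t => Q t * u t) x); split.
- by apply: (eq_derives (derivesD hd0 (pint2_derives cQu))) => x; rewrite ue.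
- apply: (derives_eq (derivesD (derivesD (derives_cst c1) (derives_pint cF)) (derives_pint cQu))).
  by move=> x; rewrite add0r addrC.
- by rewrite ue /d0 !pint0 mulr0 !addr0.
- by rewrite !pint0 !addr0.
Qed.

End LinearODE.

(** * Even solutions as functions of the spectral parameter: Wronskians and reflections *)

Section EvenSolutions.
Variable R : realType.
Implicit Types (u du Q V : R -> R) (T X l m : R).

Lemma linear_ode_unique_at u du v dv Q (x0 : R) : continuous Q ->
  derives u du -> derives du (fun x => Q x * u x) ->
  derives v dv -> derives dv (fun x => Q x * v x) ->
  u x0 = v x0 -> du x0 = dv x0 -> forall x, u x = v x /\ du x = dv x.
Proof.
move=> cQ hu hdu hv hdv e1 e2.
pose d x := u (x + x0) - v (x + x0); pose dd x := du (x + x0) - dv (x + x0).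
have cQ' : continuous (fun x => Q (x + x0)).
  move=> y; apply: (@continuous_comp _ _ _ (fun x => x + x0) Q); last exact: cQ.
  exact: (derives_continuous (derivesD (@derives_id R) (derives_cst x0))).
have hd : derives d dd by exact: derivesB (derives_translate x0 hu) (derives_translate x0 hv).
have hdd : derives dd (fun x => Q (x + x0) * d x).
  apply: (derives_eq (derivesB (derives_translate x0 hdu) (derives_translate x0 hdv))) => x.
  by rewrite /d; ring.
have d0 : forall x, d x = 0.
  by apply: (linear_ode_unique cQ' hd hdd); rewrite /d /dd add0r ?e1 ?e2 subrr.
have uv x : u x = v x by have /eqP := d0 (x - x0); rewrite /d subrK subr_eq0 => /eqP.
move=> x; split=> //; apply: (derives_unique hu); exact: (eq_derives hv).
Qed.

(** Factoring u - v out of u^5 - v^5 turns the equation for the difference into a linear one with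
    continuous coefficient. This lemma converts symmetries of the initial data into symmetries of
    the wave. *)
Lemma duffing_unique (om : R) u du v dv :
  derives u du -> derives du (fun x => om * u x - u x ^+ 5) ->
  derives v dv -> derives dv (fun x => om * v x - v x ^+ 5) ->
  u 0 = v 0 -> du 0 = dv 0 -> forall x, u x = v x.
Proof.
move=> hu hdu hv hdv e1 e2 x.
pose Q x := om - (u x ^+ 4 + u x ^+ 3 * v x + u x ^+ 2 * v x ^+ 2 + u x * v x ^+ 3 + v x ^+ 4).
have cQ : continuous Q.
  have H := derivesB (derives_cst om) (derivesD (derivesD (derivesD (derivesD (derivesX 4 hu)
    (derivesM (derivesX 3 hu) hv)) (derivesM (derivesX 2 hu) (derivesX 2 hv)))
    (derivesM hu (derivesX 3 hv))) (derivesX 4 hv)).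
  exact: (derives_continuous H).
have hd := derivesB hu hv.
have hdd : derives (fun x => du x - dv x) (fun x => Q x * (u x - v x)).
  by apply: (derives_eq (derivesB hdu hdv)) => z; rewrite /Q; ring.
apply/eqP; rewrite -subr_eq0; apply/eqP.
by apply: (linear_ode_unique cQ hd hdd); rewrite ?e1 ?e2 subrr.
Qed.

Definition even_family V (y dy : R -> R -> R) := forall l,
  [/\ derives (y l) (dy l), derives (dy l) (fun x => (V x - l) * y l x),
      y l 0 = 1 & dy l 0 = 0].

Lemma even_family_exists V : continuous V -> exists y dy, even_family V y dy.
Proof.
move=> cV.
have H l : exists p : (R -> R) * (R -> R), [/\ derives p.1 p.2,
    derives p.2 (fun x => (V x - l) * p.1 x), p.1 0 = 1 & p.2 0 = 0].
  have cQ : continuous (fun x => V x - l).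
    by apply: continuousB_fun => //; exact: (derives_continuous (derives_cst l)).
  have [u [du [h1 h2 h3 h4]]] :=
    linear_ode_exists 1 0 cQ (derives_continuous (@derives_cst R 0)).
  exists (u, du); split=> //=; apply: (derives_eq h2) => x; exact: addr0.
have [p Hp] := choice H.
by exists (fun l => (p l).1), (fun l => (p l).2) => l; have := Hp l.
Qed.

Section Family.
Variables (V : R -> R) (y dy : R -> R -> R).
Hypotheses (cV : continuous V) (yE : even_family V y dy).

Let cVl l : continuous (fun x => V x - l).
Proof. by apply: continuousB_fun => //; exact: (derives_continuous (derives_cst l)). Qed.

Lemma even_family_unique l u du : derives u du ->
  derives du (fun x => (V x - l) * u x) -> du 0 = 0 ->
  forall x, u x = u 0 * y l x /\ du x = u 0 * dy l x.
Proof.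
move=> hu hdu du0; have [h1 h2 h3 h4] := yE l.
apply: (linear_ode_unique_at (x0 := 0) (@cVl l) hu hdu (derivesZ (u 0) h1)).
- by apply: (derives_eq (derivesZ (u 0) h2)) => x; ring.
- by rewrite h3 mulr1.
- by rewrite h4 mulr0.
Qed.

(** The difference y_m - y_l has zero initial data and forcing (l - m) y_l, so Gronwall bounds it by
    a multiple of |m - l| on [0, X]. *)
Lemma even_family_unif X l (e : R) : 0 <= X -> 0 < e ->
  exists2 d : R, 0 < d & forall m, `|m - l| < d -> forall x : R, 0 <= x <= X ->
    `|y m x - y l x| < e /\ `|dy m x - dy l x| < e.
Proof.
move=> X0 e0.
have [M M0 HM] := continuous_bounded 0 X (@cVl l).
have [h1 h2 h3 h4] := yE l.
have [B B0 HB] := continuous_bounded 0 X (derives_continuous h1).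
(* The [+ 1] gives D <= D^2, which turns the energy bound into the square of |m - l| B D. The
   coefficient bound M + 1 uses |m - l| < 1. *)
pose D := X * expR ((M + 1 + 2) * X) + 1.
have D1 : 1 <= D by rewrite /D lerDr mulr_ge0 // expR_ge0.
have BD : 0 < B * D + 1 by nra.
exists (Num.min 1 (e / (B * D + 1))); first by rewrite lt_min ltr01 divr_gt0.
move=> m; rewrite lt_min => /andP[m1 me] x xX.
have [k1 k2 k3 k4] := yE m.
pose F x := (l - m) * y l x.
have hd := derivesB k1 h1.
have hdd : derives (fun x => dy m x - dy l x) (fun x => (V x - m) * (y m x - y l x) + F x).
  by apply: (derives_eq (derivesB k2 h2)) => z; rewrite /F; ring.
have QM (z : R) : 0 <= z <= X -> `|V z - m| <= M + 1.
  move=> zX; have -> : V z - m = (V z - l) - (m - l) by ring.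
  by apply: (le_trans (ler_normB _ _)); apply: lerD; [exact: HM|exact: ltW].
have FM (z : R) : 0 <= z <= X -> `|F z| <= `|m - l| * B.
  by move=> zX; rewrite /F normrM distrC ler_wpM2l // HB.
have M1 : 0 <= M + 1 by lra.
have := gronwall hd hdd M1 QM FM xX.
rewrite h3 h4 k3 k4 !subrr !expr0n /= !add0r => G.
have G' : (y m x - y l x) ^+ 2 + (dy m x - dy l x) ^+ 2 <= (`|m - l| * (B * D)) ^+ 2.
  apply: (le_trans G); rewrite mulrA [in leRHS]exprMn -mulrA ler_wpM2l ?sqr_ge0 //.
  move: xX => /andP[x0 xX].
  apply: (@le_trans _ _ (X * expR ((M + 1 + 2) * X))).
    by apply: ler_pM => //; rewrite ?expR_ge0 // ler_expR ler_wpM2l //; lra.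
  rewrite -/D expr2; apply: (@le_trans _ _ D); first by rewrite /D lerDl.
  by rewrite ler_peMr //; lra.
have lt1 : `|m - l| * (B * D) < e.
  move: me; rewrite ltr_pdivlMr // => me; apply: le_lt_trans me.
  by rewrite ler_wpM2l // lerDl.
have c0 : 0 <= `|m - l| * (B * D) by rewrite mulr_ge0 // mulr_ge0 //; lra.
split; apply: le_lt_trans lt1; rewrite -(ger0_norm c0) -ler_sqr ?nnegrE ?normr_ge0 //;
  rewrite -[leLHS]/(`|_| ^+ 2) !real_normK ?num_real //; apply: le_trans G'.
- by rewrite lerDl sqr_ge0.
- by rewrite lerDr sqr_ge0.
Qed.

Lemma even_family_continuous X : 0 <= X ->
  continuous (fun l => y l X) /\ continuous (fun l => dy l X).
Proof.
move=> X0; have XX : 0 <= X <= X by rewrite X0 lexx.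
split => l; apply/cvgrPdist_lt => e e0; have [d d0 H] := even_family_unif l X0 e0;
  exists d => //= m /=; rewrite distrC => /H/(_ _ XX)[h1 h2]; by rewrite distrC.
Qed.

Lemma even_family_wronskian l m :
  derives (fun x => y l x * dy m x - dy l x * y m x) (fun x => (l - m) * (y l x * y m x)).
Proof.
have [h1 h2 _ _] := yE l; have [k1 k2 _ _] := yE m.
by apply: (derives_eq (derivesB (derivesM h1 k2) (derivesM h2 k1))) => x; ring.
Qed.

(** For m < l the Wronskian starts from 0 and has derivative (l - m) y_l y_m > 0, so it cannot
    vanish at T. Two solutions sharing a Dirichlet or a Neumann condition at T have zero Wronskian
    there. *)
Lemma even_family_pos_unique T l m : 0 < T ->
  (forall x : R, 0 <= x < T -> 0 < y l x) -> (forall x : R, 0 <= x < T -> 0 < y m x) ->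
  y l T * dy m T - dy l T * y m T = 0 -> l = m.
Proof.
move=> T0 pl pm WT.
wlog lm : l m pl pm WT / m < l.
  move=> H; case: (ltgtP l m) => // h; last exact: H.
  by apply/esym; apply: H => //; rewrite -(oppr0) -WT; ring.
have := derives_incr (even_family_wronskian l m) T0.
have [_ _ h3 h4] := yE l; have [_ _ k3 k4] := yE m.
rewrite WT h3 h4 k3 k4 mulr0 mul0r subr0 ltxx => W.
suff : false by [].
apply: W => x /andP[x0 xT].
by rewrite !mulr_gt0 ?subr_gt0 ?pl ?pm // (ltW x0).
Qed.

Lemma even_family_isolated X l : 0 < X ->
  exists2 e : R, 0 < e & forall m, dy l X = 0 -> dy m X = 0 -> `|m - l| < e -> m = l.
Proof.
move=> X0; have [h1 h2 h3 h4] := yE l.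
have cy := derives_continuous h1.
have hP := derives_pint (continuousM_fun cy cy).
have [B B0 HB] := continuous_bounded 0 X cy.
have P0 : 0 < pint (fun x => y l x * y l x) X.
  have PX : 0 <= pint (fun x => y l x * y l x) X.
    rewrite -[leLHS](pint0 (fun x => y l x * y l x)).
    by apply: (derives_nondecr hP (ltW X0)) => x _; rewrite -expr2 sqr_ge0.
  rewrite lt_neqAle PX andbT; apply/eqP => PX0.
  have : dy l 0 ^+ 2 + y l 0 ^+ 2 = 0; last first.
    by rewrite h3 h4 expr0n expr1n add0r => /eqP; rewrite oner_eq0.
  exfalso.
  have : \forall z \near 0, 0 < y l z.
    by apply: (cvgr_gt _ (cy 0)); rewrite h3.
  case=> e /= e0 He.
  pose z := Num.min (e / 2) X.
  have z0 : 0 < z by rewrite lt_min X0 divr_gt0.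
  have zX : z <= X by rewrite ge_min lexx orbT.
  have ze : z <= e / 2 by rewrite ge_min lexx.
  have : pint (fun x => y l x * y l x) 0 < pint (fun x => y l x * y l x) z.
    apply: (derives_incr hP z0) => x /andP[x0 xz].
    have : 0 < y l x by apply: He => /=; rewrite sub0r normrN gtr0_norm //; lra.
    by move=> ?; rewrite mulr_gt0.
  rewrite pint0 ltNge PX0; move/negP; apply.
  by apply: (derives_nondecr hP zX) => x _; rewrite -expr2 sqr_ge0.
(* This e makes the integral of y_l (y_m - y_l) smaller in modulus than the integral of y_l^2. *)
pose e := pint (fun x => y l x * y l x) X / (X * (B + 1)).
have e0 : 0 < e by rewrite divr_gt0 // mulr_gt0 //; lra.
have [d d0 H] := even_family_unif l (ltW X0) e0.
exists d => // m lX mX ml; apply/eqP; apply/negPn/negP => nml.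
have nlm : l - m != 0 by rewrite subr_eq0 eq_sym.
have [k1 k2 k3 k4] := yE m.
(* W / (l - m) minus the primitive of y_l^2 has derivative y_l (y_m - y_l), and the boundary
   conditions reduce its value at X to minus the integral of y_l^2; the mean value theorem compares
   the two. *)
have hG := derivesB (derivesZ (l - m)^-1 (even_family_wronskian l m)) hP.
have [c cX] := derives_MVT hG (ltW X0).
rewrite lX mX h3 h4 k3 k4 !mulr0 !mul0r !subrr mulr0 pint0 !subr0 sub0r mulKf // => E.
have [h _] := H m ml c cX.
have : `|y l c * y m c - y l c * y l c| * X < (B + 1) * e * X.
  rewrite ltr_pM2r // -mulrBr normrM.
  have := HB c cX; have := normr_ge0 (y l c); have := normr_ge0 (y m c - y l c); nra.
rewrite -{1}(gtr0_norm X0).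
rewrite -normrM -E normrN (gtr0_norm P0) /e.
have -> : (B + 1) * (pint (fun x => y l x * y l x) X / (X * (B + 1))) * X = pint (fun x => y l x * y l x) X.
  by field; rewrite (gt_eqF X0) /= gt_eqF //; lra.
by rewrite ltxx.
Qed.

(** While y_l >= 0 the equation makes y_l' and then y_l nondecreasing, so y_l stays above y_l(0) = 1
    and a first zero is impossible. *)
Lemma even_family_ge1 T l : 0 < T -> (forall x : R, 0 <= x <= T -> 0 <= V x - l) ->
  forall x : R, 0 <= x <= T -> 0 <= dy l x /\ 1 <= y l x.
Proof.
move=> T0 Vl.
have [h1 h2 h3 h4] := yE l.
have key (b : R) : 0 <= b <= T -> (forall x : R, 0 <= x <= b -> 0 <= y l x) ->
    forall x : R, 0 <= x <= b -> 0 <= dy l x /\ 1 <= y l x.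
  move=> /andP[b0 bT] yb.
  have D (x : R) : 0 <= x <= b -> 0 <= dy l x.
    move=> /andP[x0 xb]; rewrite -h4; apply: (derives_nondecr h2 x0) => z /andP[z0 zx].
    by rewrite mulr_ge0 // ?Vl ?yb // z0 (le_trans zx) // (le_trans xb).
  move=> x /andP[x0 xb]; split; first by apply: D; rewrite x0.
  rewrite -h3; apply: (derives_nondecr h1 x0) => z /andP[z0 zx].
  by apply: D; rewrite z0 (le_trans zx).
have pos (x : R) : 0 <= x <= T -> 0 < y l x.
  move=> /andP[x0 xT]; rewrite ltNge; apply/negP => yx.
  have [|al [/andP[al0 alx] yal ypos]] := first_zero (derives_continuous h1) _ x0 yx.
    by rewrite h3.
  have [|||_] := key al _ _ al.
  - by rewrite (ltW al0) (le_trans alx).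
  - move=> z /andP[z0]; rewrite le_eqVlt => /predU1P[->|zal]; first by rewrite yal.
    by rewrite ltW // ypos // z0.
  - by rewrite (ltW al0) lexx.
  by rewrite yal ler10.
by apply: key => [|x xT]; [rewrite (ltW T0) lexx|rewrite ltW // pos].
Qed.

Section Reflection.
Variable c : R.
Hypothesis Vc : forall x, V (c - x) = V x.

Lemma reflect_solution l u du : derives u du ->
  derives du (fun x => (V x - l) * u x) ->
  derives (fun x => u (c - x)) (fun x => - du (c - x)) /\
  derives (fun x => - du (c - x)) (fun x => (V x - l) * u (c - x)).
Proof.
move=> h1 h2; split; first exact: derives_reflect.
by apply: (derives_eq (derivesN (derives_reflect c h2))) => x; rewrite opprK Vc.
Qed.

(** The reflected solution has slope - y_l'(c) = 0 at 0, so it is a multiple of y_l. *)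
Lemma even_family_reflect l : dy l c = 0 ->
  forall x, y l (c - x) = y l c * y l x /\ - dy l (c - x) = y l c * dy l x.
Proof.
move=> dc; have [h1 h2 _ _] := yE l; have [k1 k2] := reflect_solution h1 h2.
have := even_family_unique k1 k2; rewrite subr0 dc oppr0; exact.
Qed.

End Reflection.

(** If y_l(T) is nonzero, the reflection factor y_l(2T) must be 1 and y_l is even about T.
    Conversely y_l has the same data at T as its reflection, or as minus its reflection, hence
    equals it. *)
Lemma even_family_half_period T l : (forall x, V (2 * T - x) = V x) ->
  dy l (2 * T) = 0 <-> y l T = 0 \/ dy l T = 0.
Proof.
move=> VT; have [h1 h2 h3 h4] := yE l.
have TT : 2 * T - T = T by ring.
split=> [d2|].
  have [e1 e2] := even_family_reflect VT d2 T; rewrite TT in e1 e2.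
  case: (eqVneq (y l T) 0) => yT; [by left|right].
  have c1 : y l (2 * T) = 1.
    by apply: (mulIf yT); rewrite mul1r -e1.
  by move: e2; rewrite c1 mul1r; lra.
have [k1 k2] := reflect_solution VT h1 h2.
have T0 : 2 * T - 2 * T = 0 by ring.
case=> e.
  have := linear_ode_unique_at (x0 := T) (@cVl l) h1 h2 (derivesN k1) (dv := fun x => - - dy l (2 * T - x)).
  rewrite TT e opprK oppr0 => H.
  have [] := H _ _ _ (2 * T).
  - by apply: (derives_eq (derivesN k2)) => x; ring.
  - by [].
  - by [].
  by rewrite T0 h4 !oppr0.
have := linear_ode_unique_at (x0 := T) (@cVl l) h1 h2 k1 k2.
rewrite TT e oppr0 => H.
have [] := H _ _ (2 * T) => //.
by rewrite T0 h4 oppr0.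
Qed.

Hypothesis Veven : forall x, V (- x) = V x.

Lemma even_family_even l x : y l (- x) = y l x.
Proof.
have [h1 h2 h3 h4] := yE l.
have h0 : forall x, V (0 - x) = V x by move=> z; rewrite sub0r.
by have [+ _] := even_family_reflect h0 h4 x; rewrite sub0r h3 mul1r.
Qed.

(** A translation by 2X is composed of two reflections x -> X - x and sign changes; each reflection
    contributes the factor y_l(X), whose square is 1. *)
Lemma even_family_periodic X l : (forall x, V (X - x) = V x) -> dy l X = 0 ->
  forall x, y l (x + 2 * X) = y l x.
Proof.
move=> VX dX; have E := even_family_reflect VX dX.
have [h1 h2 h3 h4] := yE l.
have c2 : y l X * y l X = 1.
  by have [+ _] := E X; rewrite subrr h3.
move=> x.
have -> : x + 2 * X = X - (- (x + X)) by ring.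
have [-> _] := E (- (x + X)); rewrite even_family_even.
have -> : x + X = X - (- x) by ring.
by have [-> _] := E (- x); rewrite even_family_even mulrA c2 mul1r.
Qed.

End Family.
End EvenSolutions.

(** * Sturm comparison on a quarter period for both components *)

Section Sturm.
Variable R : realType.

Lemma derives_neg_right (f df : R -> R) (al x : R) : derives f df -> f al = 0 ->
  df al < 0 -> al < x -> exists x1, al < x1 <= x /\ forall z : R, al < z <= x1 -> f z < 0.
Proof.
move=> h fal d0 alx.
have /is_derive1_caratheodory [g [fE gC gE]] := h al.
have : \forall z \near al, g z < 0 by apply: (cvgr_lt _ gC); rewrite gE.
case=> e /= e0 He.
exists (Num.min x (al + e / 2)); split.
  by rewrite lt_min alx ltrDl divr_gt0 //= ge_min lexx.
move=> z /andP[alz]; rewrite le_min => /andP[_ ze].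
have gz : g z < 0.
  by apply: He => /=; rewrite distrC gtr0_norm ?subr_gt0 //; lra.
have := fE z; rewrite fal subr0 => ->; rewrite nmulr_rlt0 // subr_gt0 //.
Qed.

Lemma first_zero_between (f : R -> R) (a b : R) : continuous f -> 0 < f a -> a <= b -> f b <= 0 ->
  exists al : R, [/\ a < al <= b, f al = 0 & forall x : R, a <= x < al -> 0 < f x].
Proof.
move=> cf fa ab fb.
have cg : continuous (fun t => f (t + a)).
  move=> y; apply: (@continuous_comp _ _ _ (fun x => x + a) f); last exact: cf.
  exact: (derives_continuous (derivesD (@derives_id R) (derives_cst a))).
have [|||al [/andP[h1 h2] h3 h4]] := first_zero cg (b := b - a).
- by rewrite add0r.
- by rewrite subr_ge0.
- by rewrite subrK.
exists (al + a); split => //; first by apply/andP; split; lra.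
move=> x /andP[h5 h6]; rewrite -[x](subrK a); apply: h4; apply/andP; split; lra.
Qed.

Variables (T om : R) (phi dphi : R -> R).
Hypotheses (T0 : 0 < T) (om0 : 0 < om).
Hypotheses (hphi : derives phi dphi)
  (hdphi : derives dphi (fun x => om * phi x - phi x ^+ 5)).
Hypotheses (dphi0 : dphi 0 = 0) (phiT : phi T = 0)
  (dneg : forall x : R, 0 < x <= T -> dphi x < 0).
Let a := phi 0.
Let V1 x := om - 5 * phi x ^+ 4.
Let V2 x := om - phi x ^+ 4.

Lemma profile_decr (x z : R) : 0 <= x -> x < z -> z <= T -> phi z < phi x.
Proof.
move=> x0 xz zT; rewrite -ltrN2.
apply: (derives_incr (derivesN hphi) xz) => t /andP[xt tz].
by rewrite oppr_gt0 dneg // (le_lt_trans x0) //= (le_trans (ltW tz)).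
Qed.

Lemma profile_pos (x : R) : 0 <= x < T -> 0 < phi x.
Proof. by move=> /andP[x0 xT]; rewrite -phiT; exact: profile_decr. Qed.

Lemma profile_ge0 (x : R) : 0 <= x <= T -> 0 <= phi x.
Proof.
move=> /andP[x0]; rewrite le_eqVlt => /predU1P[->|xT]; first by rewrite phiT.
by rewrite ltW // profile_pos // x0.
Qed.

Lemma profile0_gt0 : 0 < a.
Proof. by apply: profile_pos; rewrite lexx. Qed.

Lemma profile_lt (x : R) : 0 < x <= T -> phi x < a.
Proof. by move=> /andP[x0 xT]; exact: profile_decr. Qed.

Lemma profile_le (x : R) : 0 <= x <= T -> phi x <= a.
Proof.
move=> /andP[]; rewrite le_eqVlt => /predU1P[<-//|x0 xT].
by rewrite ltW // profile_lt // x0.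
Qed.

Lemma profile4_le (x : R) : 0 <= x <= T -> phi x ^+ 4 <= a ^+ 4.
Proof.
move=> xT; apply: lerXn2r; rewrite ?nnegrE ?(profile_ge0 xT) ?(profile_le xT) //.
exact: ltW profile0_gt0.
Qed.

(** First integral of the equation of phi, its constant read off at 0 where phi' = 0. *)
Lemma profile_energy x :
  dphi x ^+ 2 = om * phi x ^+ 2 - phi x ^+ 6 / 3 + (a ^+ 6 / 3 - om * a ^+ 2).
Proof.
have h := derivesB (derivesB (derivesX 2 hdphi) (derivesZ om (derivesX 2 hphi)))
  (derivesZ (- 3^-1) (derivesX 6 hphi)).
have {}h : derives (fun x => dphi x ^+ 2 - om * phi x ^+ 2 - - 3^-1 * phi x ^+ 6) (fun=> 0).
  by apply: (derives_eq h) => z /=; field.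
have := derives0_cst x 0 h; rewrite /= dphi0 -/a => H.
have -> : dphi x ^+ 2 = (dphi x ^+ 2 - om * phi x ^+ 2 - - 3^-1 * phi x ^+ 6) +
   om * phi x ^+ 2 - phi x ^+ 6 / 3 by field.
by rewrite H; field.
Qed.

(** At T the energy identity reads phi'(T)^2 = a^2 (a^4 - 3 om) / 3, and phi'(T) < 0. *)
Lemma profile_amplitude : 3 * om < a ^+ 4.
Proof.
have := profile_energy T; rewrite phiT !expr0n /= mul0r mulr0 subrr add0r => E.
have : 0 < dphi T ^+ 2 by rewrite exprn_even_gt0 //= lt_eqF // dneg // T0 lexx.
rewrite E.
have -> : a ^+ 6 / 3 - om * a ^+ 2 = a ^+ 2 * (a ^+ 4 - 3 * om) / 3 by field.
rewrite pmulr_lgt0 ?invr_gt0 // pmulr_rgt0 ?exprn_gt0 ?profile0_gt0 //.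
by rewrite subr_gt0.
Qed.

Lemma profile_even x : phi (- x) = phi x.
Proof.
apply: (duffing_unique (om := om) (derives_opp hphi) _ hphi hdphi).
- by apply: (derives_eq (derivesN (derives_opp hdphi))) => z; rewrite opprK.
- by rewrite oppr0.
- by rewrite oppr0 dphi0 oppr0.
Qed.

(** As phi(T) = 0, the functions phi(T - t) and - phi(T + t) solve the same equation with the same
    data at t = 0. *)
Lemma profile_odd x : phi (2 * T - x) = - phi x.
Proof.
have hT := derives_translate T hphi; have hdT := derives_translate T hdphi.
have hN : derives (fun x => - dphi (x + T)) (fun x => om * - phi (x + T) - (- phi (x + T)) ^+ 5).
  by apply: (derives_eq (derivesN hdT)) => z; ring.
have := duffing_unique (om := om) (derives_opp hT) _ (derivesN hT) hN _ _ (T - x).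
have -> : - (T - x) + T = x by ring.
have -> : T - x + T = 2 * T - x by ring.
move=> -> //; first by rewrite opprK.
- apply: (derives_eq (derivesN (derives_opp hdT))) => z; by rewrite opprK.
- by rewrite oppr0 add0r phiT oppr0.
- by rewrite oppr0.
Qed.

Lemma potential1_continuous : continuous V1.
Proof.
exact: (derives_continuous (derivesB (derives_cst om) (derivesZ 5 (derivesX 4 hphi)))).
Qed.

Lemma potential2_continuous : continuous V2.
Proof. exact: (derives_continuous (derivesB (derives_cst om) (derivesX 4 hphi))). Qed.

Lemma potential1_even x : V1 (- x) = V1 x.
Proof. by rewrite /V1 profile_even. Qed.

Lemma potential2_even x : V2 (- x) = V2 x.
Proof. by rewrite /V2 profile_even. Qed.

Lemma potential1_reflect x : V1 (2 * T - x) = V1 x.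
Proof. by rewrite /V1 profile_odd; ring. Qed.

Lemma potential2_reflect x : V2 (2 * T - x) = V2 x.
Proof. by rewrite /V2 profile_odd; ring. Qed.

Lemma even_family_simple_zero V (y dy : R -> R -> R) l x : continuous V ->
  even_family V y dy -> y l x = 0 -> dy l x != 0.
Proof.
move=> cV yE yx; apply/eqP => dyx; have [h1 h2 h3 h4] := yE l.
have cVl : continuous (fun x => V x - l).
  by apply: continuousB_fun => //; exact: (derives_continuous (derives_cst l)).
have := linear_ode_unique_at (x0 := x) (v := fun=> 0) (dv := fun=> 0) cVl h1 h2 (derives_cst 0).
have h0 : derives (fun=> 0) (fun x => (V x - l) * 0).
  by apply: (derives_eq (derives_cst 0)) => z; rewrite mulr0.
move=> /(_ h0 yx dyx 0)[]; rewrite h3 => /eqP; rewrite oner_eq0 //.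
Qed.

Section First.
Variables y dy : R -> R -> R.
Hypothesis yE : even_family V1 y dy.

(* W = phi' y' - phi'' y satisfies W' = - l phi' y, because L_1 phi' = 0. *)
Lemma sturm1_after_zero l al : l <= 0 -> 0 < al <= T -> y l al = 0 ->
  (forall x : R, 0 <= x < al -> 0 < y l x) ->
  (forall x : R, al < x <= T -> y l x < 0) /\ dy l T < 0.
Proof.
move=> l0 /andP[al0 alT] yal ypos; have [h1 h2 h3 h4] := yE l.
have dyal : dy l al < 0.
  rewrite lt_neqAle (even_family_simple_zero potential1_continuous yE yal) /=.
  by apply: (derives_min_right h1 al0) => x /ypos/ltW; rewrite yal.
pose W x := dphi x * dy l x - (om * phi x - phi x ^+ 5) * y l x.
have hW : derives W (fun x => - l * (dphi x * y l x)).
  apply: (derives_eq (derivesB (derivesM hdphi h2)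
    (derivesM (derivesB (derivesZ om hphi) (derivesX 5 hphi)) h1))) => x.
  by rewrite /V1 /=; ring.
have Wal : 0 < W al.
  by rewrite /W yal mulr0 subr0 nmulr_rgt0 // dneg // al0.
have Wpos (b : R) : al <= b -> b <= T -> (forall x : R, al < x < b -> y l x < 0) -> y l b <= 0 -> 0 < W b.
  move=> alb bT yneg yb; apply: (lt_le_trans Wal); apply: (derives_nondecr hW alb) => x /andP[ax xb].
  have x0 : 0 < x by exact: lt_le_trans ax.
  have yx : y l x <= 0.
    move: ax xb; rewrite le_eqVlt => /predU1P[<-|ax]; first by rewrite yal.
    rewrite le_eqVlt => /predU1P[->//|xb]; by rewrite ltW // yneg // ax.
  have dx : dphi x <= 0 by rewrite ltW // dneg // x0 (le_trans xb).
  by rewrite mulr_ge0 ?oppr_ge0 // mulr_le0.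
have neg (x : R) : al < x <= T -> y l x < 0.
  move=> /andP[alx xT]; rewrite ltNge; apply/negP => yx.
  (* The search for a second zero starts at x1, where y_l is already negative. At such a zero [be]
     one would have y_l' >= 0, hence W <= 0, against [Wpos]. *)
  have [x1 [/andP[alx1 x1x] yneg]] := derives_neg_right h1 yal dyal alx.
  have cyN := derives_continuous (derivesN h1).
  have [||be [/andP[x1be bex] ybe ybneg]] := first_zero_between cyN (a := x1) _ x1x.
  - by rewrite oppr_gt0 yneg // alx1 lexx.
  - by rewrite oppr_le0.
  move/eqP: ybe; rewrite oppr_eq0 => /eqP ybe.
  have albe : al < be by exact: lt_trans x1be.
  have beT : be <= T by exact: le_trans xT.
  have : 0 < W be.
    apply: Wpos => //; rewrite ?ybe ?(ltW albe) // => z /andP[alz zbe].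
    case: (leP z x1) => zx1; first by rewrite yneg // alz.
    by rewrite -oppr_gt0 ybneg // (ltW zx1).
  rewrite /W ybe mulr0 subr0.
  have dbe : dphi be < 0 by rewrite dneg // (lt_trans al0).
  rewrite nmulr_rgt0 // ltNge => /negP; apply.
  rewrite -oppr_le0; apply: (derives_min_right (derivesN h1) x1be) => z /andP[x1z zbe].
  by rewrite ybe oppr0 ltW // ybneg // x1z.
split=> //.
(* At T both phi and phi'' vanish, so W(T) = phi'(T) y_l'(T), and its sign determines that of
   y_l'(T). *)
have : 0 < W T.
  apply: Wpos => //.
    by move=> x /andP[alx xT]; rewrite neg // alx ltW.
  by move: alT; rewrite le_eqVlt => /predU1P[<-|alT]; rewrite ?yal // ltW // neg // alT lexx.
rewrite /W phiT expr0n /= mulr0 subrr mul0r subr0 nmulr_rgt0 // dneg // T0 lexx //.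
Qed.

Lemma sturm1_neumann_pos l : l <= 0 -> dy l T = 0 ->
  forall x : R, 0 <= x <= T -> 0 < y l x.
Proof.
move=> l0 dT x /andP[x0 xT]; rewrite ltNge; apply/negP => yx.
have [h1 h2 h3 h4] := yE l.
have [|al [/andP[al0 alx] yal ypos]] := first_zero (derives_continuous h1) _ x0 yx.
  by rewrite h3.
have al0T : 0 < al <= T by rewrite al0 (le_trans alx).
by have [_] := sturm1_after_zero l0 al0T yal ypos; rewrite dT ltxx.
Qed.

(** A first zero before T would force y_l(T) < 0. *)
Lemma sturm1_dirichlet_pos l : l <= 0 -> y l T = 0 ->
  (forall x : R, 0 <= x < T -> 0 < y l x) /\ dy l T < 0.
Proof.
move=> l0 yT; have [h1 h2 h3 h4] := yE l.
have [||al [/andP[al0 alT] yal ypos]] := first_zero (derives_continuous h1) (b := T) _ (ltW T0).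
- by rewrite h3.
- by rewrite yT.
have al0T : 0 < al <= T by rewrite al0.
have [yneg dT] := sturm1_after_zero l0 al0T yal ypos; split=> // x /andP[x0 xT].
move: alT; rewrite le_eqVlt => /predU1P[alT|alT]; first by apply: ypos; rewrite x0 alT.
by have := yneg T; rewrite alT lexx yT ltxx => /(_ isT).
Qed.

(* p = phi^3 satisfies L_1 p < (- 2 a^4 - 2 om) p on (0, T). *)
Lemma sturm1_trial : y (- 2 * a ^+ 4 - 2 * om) T <= 0.
Proof.
set l := _ - _; rewrite leNgt; apply/negP => yT.
have a0 := profile0_gt0; have aom := profile_amplitude.
have l0 : l <= 0 by rewrite /l; move: (exprn_gt0 4 a0) om0; lra.
have [h1 h2 h3 h4] := yE l.
have ypos (x : R) : 0 <= x <= T -> 0 < y l x.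
  move=> /andP[x0 xT]; rewrite ltNge; apply/negP => yx.
  have [|al [/andP[al0 alx] yal ypos]] := first_zero (derives_continuous h1) _ x0 yx.
    by rewrite h3.
  have alT := le_trans alx xT.
  have al0T : 0 < al <= T by rewrite al0.
  have [yneg _] := sturm1_after_zero l0 al0T yal ypos.
  move: alT; rewrite le_eqVlt => /predU1P[alT|alT].
    by move: yT; rewrite -alT yal ltxx.
  by have := yneg T; rewrite alT lexx => /(_ isT)/(lt_trans yT); rewrite ltxx.
(* Wronskian of phi^3 and y_l. Since phi^3 vanishes at T together with its derivative, W(T) = 0
   whatever y_l does there, while W(0) = 0 and W would be increasing. *)
pose W x := 3 * phi x ^+ 2 * dphi x * y l x - phi x ^+ 3 * dy l x.
have hW : derives W (fun x => (2 * a ^+ 4 - 6 * om) * (phi x * (a ^+ 2 - phi x ^+ 2) * y l x)).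
  apply: (derives_eq (derivesB (derivesM (derivesM (derivesZ 3 (derivesX 2 hphi)) hdphi) h1)
    (derivesM (derivesX 3 hphi) h2))) => x.
  have -> : (2 * a ^+ 4 - 6 * om) * (phi x * (a ^+ 2 - phi x ^+ 2) * y l x) =
     (6 * phi x * (om * phi x ^+ 2 - phi x ^+ 6 / 3 + (a ^+ 6 / 3 - om * a ^+ 2))
      + 3 * phi x ^+ 2 * (om * phi x - phi x ^+ 5)) * y l x - phi x ^+ 3 * ((V1 x - l) * y l x).
    by rewrite /V1 /l; field.
  by rewrite -profile_energy /=; ring.
have := derives_incr hW T0.
rewrite /W dphi0 h4 phiT !expr0n /= !(mulr0, mul0r) subr0 ltxx => H.
suff : false by [].
apply: H => x /andP[x0 xT].
have px : 0 < phi x by apply: profile_pos; rewrite (ltW x0).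
have pxa : phi x < a by apply: profile_lt; rewrite x0 ltW.
rewrite !mulr_gt0 ?ypos ?(ltW x0) ?(ltW xT) //; first by lra.
by rewrite subr_gt0; nra.
Qed.

Lemma sturm1 : exists mu0 mu1 : R, [/\ mu0 < mu1, mu1 <= - 2 * a ^+ 4 - 2 * om,
  dy mu0 T = 0, y mu1 T = 0 &
  forall l, l <= 0 -> (dy l T = 0 -> l = mu0) /\ (y l T = 0 -> l = mu1)].
Proof.
have a0 := profile0_gt0; have aom := profile_amplitude.
(* On [0, T] one has V1 >= om - 5 a^4 > l0, so at l0 both the solution and its derivative are
   positive at T. *)
pose Lam := - 2 * a ^+ 4 - 2 * om; pose l0 := - 5 * a ^+ 4.
have a4 := exprn_gt0 4 a0.
have l0L : l0 <= Lam by rewrite /l0 /Lam; lra.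
have Lam0 : Lam < 0 by rewrite /Lam; move: om0; lra.
have V0 (x : R) : 0 <= x <= T -> 0 < V1 x - l0.
  move=> xT; rewrite /V1 /l0.
  by have := profile4_le xT; move: om0; lra.
have [h1 h2 h3 h4] := yE l0.
have big := even_family_ge1 yE T0 (fun x xT => ltW (V0 x xT)).
have TT : 0 <= T <= T by rewrite (ltW T0) lexx.
have [_ yT1] := big T TT.
have dT : 0 < dy l0 T.
  rewrite -h4; apply: (derives_incr h2 T0) => x /andP[x0 xT].
  have xT' : 0 <= x <= T by rewrite (ltW x0) (ltW xT).
  have [_ y1] := big x xT'; rewrite mulr_gt0 ?V0 //.
  exact: lt_le_trans y1.
have [c1 c2] := even_family_continuous potential1_continuous yE (ltW T0).
have [|mu1 /andP[l0m1 m1L] ym1] := continuous_IVT0 c1 l0L.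
  by rewrite mulr_ge0_le0 // ?sturm1_trial // (le_trans _ yT1).
have m10 : mu1 <= 0 by rewrite ltW // (le_lt_trans m1L).
have [pm1 dm1] := sturm1_dirichlet_pos m10 ym1.
(* The derivative at T is positive for l0 and negative for the Dirichlet value mu1, so a Neumann
   value lies between them; this also gives the order of the two. *)
have [|mu0 /andP[l0m0 m0m1] dm0] := continuous_IVT0 c2 l0m1.
  by rewrite mulr_ge0_le0 // ltW.
exists mu0, mu1; split => //.
  rewrite lt_neqAle m0m1 andbT; apply/eqP => e.
  by move: dm1; rewrite -e dm0 ltxx.
have m00 : mu0 <= 0 by exact: le_trans m10.
move=> l ll; split=> H.
- apply: (even_family_pos_unique yE T0).
  + by move=> x /andP[x0 xT]; apply: (sturm1_neumann_pos ll H); rewrite x0 ltW.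
  + by move=> x /andP[x0 xT]; apply: (sturm1_neumann_pos m00 dm0); rewrite x0 ltW.
  + by rewrite H dm0 mulr0 mul0r subr0.
- apply: (even_family_pos_unique yE T0) => //.
  + by have [] := sturm1_dirichlet_pos ll H.
  + by rewrite H ym1 mulr0 mul0r subr0.
Qed.

End First.

Section Second.
Variables z dz : R -> R -> R.
Hypothesis zE : even_family V2 z dz.

Lemma sturm2_zero x : phi x = a * z 0 x /\ dphi x = a * dz 0 x.
Proof.
apply: (even_family_unique potential2_continuous zE hphi _ dphi0).
by apply: (derives_eq hdphi) => t; rewrite /V2; ring.
Qed.

(* W = phi z' - phi' z satisfies W' = - l phi z, because L_2 phi = 0. *)
Lemma sturm2_pos l : l < 0 -> forall x : R, 0 <= x <= T -> 0 < z l x.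
Proof.
move=> l0 x /andP[x0 xT]; rewrite ltNge; apply/negP => zx.
have [h1 h2 h3 h4] := zE l.
have [|al [/andP[al0 alx] zal zpos]] := first_zero (derives_continuous h1) _ x0 zx.
  by rewrite h3.
have alT := le_trans alx xT.
have hW : derives (fun x => phi x * dz l x - dphi x * z l x) (fun x => - l * (phi x * z l x)).
  by apply: (derives_eq (derivesB (derivesM hphi h2) (derivesM hdphi h1))) => t; rewrite /V2; ring.
have := derives_incr hW al0.
rewrite dphi0 h4 zal !(mulr0, mul0r) !subr0 => H.
have : 0 < phi al * dz l al.
  apply: H => t /andP[t0 tal]; rewrite mulr_gt0 ?oppr_gt0 // mulr_gt0 ?profile_pos ?zpos ?(ltW t0) //=.
  exact: lt_le_trans alT.
rewrite ltNge mulr_ge0_le0 ?profile_ge0 ?(ltW al0) //.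
by apply: (derives_min_right h1 al0) => t /zpos/ltW; rewrite zal.
Qed.

(** At l = om - a^4, the minimum of V2, the solution is convex and z_l'(T) > 0; at l = 0 it is phi /
    a, with z_l'(T) < 0. A Neumann value lies strictly between. *)
Lemma sturm2 : exists nu : R, [/\ om - a ^+ 4 < nu, nu < 0, dz nu T = 0 &
  forall l, l < 0 -> z l T != 0 /\ (dz l T = 0 -> l = nu)].
Proof.
have a0 := profile0_gt0; have aom := profile_amplitude.
pose l1 := om - a ^+ 4.
have l10 : l1 < 0 by rewrite /l1; move: om0; lra.
have TT : 0 <= T <= T by rewrite (ltW T0) lexx.
have [h1 h2 h3 h4] := zE l1.
have V0 (x : R) : 0 <= x <= T -> 0 <= V2 x - l1.
  move=> xT; rewrite /V2 /l1.
  by have := profile4_le xT; move: om0; lra.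
have big := even_family_ge1 zE T0 V0.
have dT : 0 < dz l1 T.
  rewrite -h4; apply: (derives_incr h2 T0) => x /andP[x0 xT].
  have xT' : 0 <= x <= T by rewrite (ltW x0) (ltW xT).
  have [_ y1] := big x xT'; rewrite mulr_gt0 //; last exact: lt_le_trans y1.
  have : phi x ^+ 4 < a ^+ 4.
    by rewrite ltr_pXn2r ?nnegrE ?(profile_ge0 xT') ?(ltW a0) // profile_lt // x0 ltW.
  rewrite /V2 /l1; lra.
have d0T : dz 0 T < 0.
  have [_ e] := sturm2_zero T.
  by rewrite -(pmulr_rlt0 _ a0) -e dneg // T0 lexx.
have [c1 c2] := even_family_continuous potential2_continuous zE (ltW T0).
have [|nu /andP[l1nu nu0] dnu] := continuous_IVT0 c2 (ltW l10).
  by rewrite mulr_ge0_le0 // ltW.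
have nul0 : nu < 0.
  by rewrite lt_neqAle nu0 andbT; apply/eqP => e; move: d0T dnu; rewrite e => /[swap] ->; rewrite ltxx.
exists nu; split => //.
  by rewrite lt_neqAle l1nu andbT; apply/eqP => e; move: dT; rewrite /l1 e dnu ltxx.
move=> l l0; split; first by rewrite gt_eqF // sturm2_pos.
move=> dl; apply: (even_family_pos_unique zE T0).
- by move=> x /andP[x0 xT]; apply: (sturm2_pos l0); rewrite x0 ltW.
- by move=> x /andP[x0 xT]; apply: (sturm2_pos nul0); rewrite x0 ltW.
- by rewrite dl dnu mulr0 mul0r subr0.
Qed.

End Second.
End Sturm.

(** * Periodic L^2 functions, weak solutions and the resolvent of one component *)

Section PeriodicL2.
Variable R : realType.
Local Notation leb := (@lebesgue_measure R).
Variable L : R.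
Hypothesis L0 : 0 < L.
Implicit Types g u w du v Q : R -> R.

Lemma measure_period : leb `[0, L] = L%:E.
Proof. by rewrite lebesgue_measure_itv /= lte_fin L0 sube0. Qed.

Lemma L2perP g : L2per L g <-> [/\ measurable_fun setT g, Defs.periodic L g &
  leb.-integrable `[0, L] (EFin \o (fun x => g x ^+ 2))].
Proof.
have E : (\int[leb]_(x in `[0%R, L]) `|((g x ^+ 2)%R)%:E| =
    \int[leb]_(x in `[0%R, L]) ((g x ^+ 2)%R)%:E)%E.
  by apply: eq_integral => x _ /=; rewrite ger0_norm // sqr_ge0.
split=> [[mg [pg ig]]|[mg pg /integrableP[_ ig]]]; last by split=> //; split=> //; rewrite -E.
split=> //; apply/integrableP; split; last by rewrite [ltLHS]E.
by apply/measurable_EFinP; apply: measurable_funTS; exact: measurable_funX.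
Qed.

Lemma integrable_periodic_translate g (a b c : R) : measurable_fun setT g ->
  (forall x, g (x + c) = g x) -> leb.-integrable `[a, b] (EFin \o g) ->
  leb.-integrable `[a + c, b + c] (EFin \o g).
Proof.
move=> mg gc /integrableP[_ h]; apply/integrableP; split.
  by apply/measurable_EFinP; apply: measurable_funTS.
have mf : measurable_fun setT (fun x : R => `|(g x)%:E|)%E.
  by apply: measurableT_comp => //; exact/measurable_EFinP.
rewrite -(@ge0_integral_translate R (fun x => `|(g x)%:E|)%E a b c mf) //.
by under eq_integral do rewrite gc.
Qed.

Lemma integrable_itv_cat g (a b c : R) : measurable_fun setT g -> a <= b -> b <= c ->
  leb.-integrable `[a, b] (EFin \o g) -> leb.-integrable `[b, c] (EFin \o g) ->
  leb.-integrable `[a, c] (EFin \o g).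
Proof.
move=> mg ab bc i1 /integrableP[_ i2].
have /integrableP[_ {}i1] : leb.-integrable `[a, b[ (EFin \o g).
  by apply: integrableS i1 => //; apply: subset_itvl; rewrite bnd_simp.
have mf : measurable_fun setT (fun x : R => `|(g x)%:E|)%E.
  by apply: measurableT_comp => //; exact/measurable_EFinP.
apply/integrableP; split; first by apply/measurable_EFinP; apply: measurable_funTS.
rewrite (@itv_bndbnd_setU _ _ _ (BLeft b)) ?bnd_simp //.
rewrite ge0_integral_setU //=; first exact: lte_add_pinfty.
  exact: measurable_funTS.
apply/disj_setPS => x [/=]; rewrite !in_itv /= => /andP[_ xb] /andP[].
by rewrite leNgt xb.
Qed.

(** On one period |g| <= 1 + g^2; translates of the period then cover any segment. *)
Lemma L2per_locint g : L2per L g -> locint g.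
Proof.
move=> /L2perP[mg pg ig].
have i1 : leb.-integrable `[0, L] (EFin \o g).
  have c1 : leb.-integrable `[0, L] (EFin \o (fun=> 1 : R)).
    exact: (continuous_locint (derives_continuous (@derives_cst R 1))).
  have := integrableD _ c1 ig => /(_ (measurable_itv _)).
  apply: le_integrable => //.
    by apply/measurable_EFinP; apply: measurable_funTS.
  move=> x _; rewrite /= lee_fin (ger0_norm (x := 1 + _)); last by rewrite addr_ge0 // sqr_ge0.
  rewrite -(@real_normK _ (g x)) ?num_real //; have := sqr_ge0 (`|g x| - 1); rewrite !expr2; nra.
have pn n x : g (x + n%:R * L) = g x.
  elim: n x => [|n IH] x; first by rewrite mul0r addr0.
  by rewrite -natr1 mulrDl mul1r addrA pg IH.
have in_ n : leb.-integrable `[0, n%:R * L] (EFin \o g).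
  elim: n => [|n IH].
    by rewrite mul0r; apply: integrableS i1 => //; apply: subset_itvl; rewrite bnd_simp ltW.
  apply: (@integrable_itv_cat g 0 (n%:R * L)) => //.
  - by rewrite mulr_ge0 // ltW.
  - by rewrite ler_pM2r // ler_nat.
  - have := integrable_periodic_translate (c := n%:R * L) mg (pn n) i1.
    by rewrite add0r -natr1 mulrDl mul1r addrC.
have inn n : leb.-integrable `[- (n%:R * L), n%:R * L] (EFin \o g).
  apply: (@integrable_itv_cat g _ 0) => //.
  - by rewrite oppr_le0 mulr_ge0 // ltW.
  - by rewrite mulr_ge0 // ltW.
  - have pn' x : g (x + - (n%:R * L)) = g x by rewrite -[in RHS](subrK (n%:R * L) x) pn.
    have := integrable_periodic_translate mg pn' (in_ n).
    by rewrite add0r subrr.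
move=> a b; pose M := (`|a| + `|b|) / L; pose n := Num.bound M.
have M0 : 0 <= M by rewrite divr_ge0 ?addr_ge0 // ltW.
have nL : `|a| + `|b| <= n%:R * L by rewrite -ler_pdivrMr // ltW // archi_boundP.
apply: integrableS (inn n) => // x /=; rewrite !in_itv /= => /andP[ax xb].
have := ler_norm b; have := ler_norm (- a); rewrite normrN.
have := normr_ge0 a; have := normr_ge0 b => *; apply/andP; split; lra.
Qed.

Lemma continuous_L2per g : continuous g -> Defs.periodic L g -> L2per L g.
Proof.
move=> cg pg; apply/L2perP; split=> //; first exact: continuous_measurable_fun.
by apply: eq_integrable (continuous_locint (continuousM_fun cg cg) 0 L) => // x _; rewrite /= expr2.
Qed.

Lemma L2perD g1 g2 : L2per L g1 -> L2per L g2 -> L2per L (fun x => g1 x + g2 x).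
Proof.
move=> /L2perP[m1 p1 i1] /L2perP[m2 p2 i2]; apply/L2perP; split.
- exact: measurable_funD.
- by move=> x; rewrite p1 p2.
have := integrableD _ (integrableZl _ 2 i1) (integrableZl _ 2 i2).
move=> /(_ (measurable_itv _) (measurable_itv _) (measurable_itv _)).
apply: le_integrable => //.
  apply/measurable_EFinP; apply: measurable_funTS; apply: measurable_funX.
  exact: measurable_funD.
move=> x _; rewrite /= lee_fin ger0_norm ?sqr_ge0 //; apply: le_trans (ler_norm _).
by have := sqr_ge0 (g1 x - g2 x); rewrite !expr2; nra.
Qed.

Lemma L2perZ g (c : R) : L2per L g -> L2per L (fun x => c * g x).
Proof.
move=> /L2perP[m1 p1 i1]; apply/L2perP; split.
- by apply: measurable_funM.
- by move=> x; rewrite p1.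
have := integrableZl _ (c ^+ 2) i1 => /(_ (measurable_itv _)).
by apply: eq_integrable => // x _ /=; rewrite exprMn.
Qed.

Lemma L2perB g1 g2 : L2per L g1 -> L2per L g2 -> L2per L (fun x => g1 x - g2 x).
Proof.
by move=> h1 h2; have := L2perD h1 (L2perZ (-1) h2); under eq_fun do rewrite mulN1r.
Qed.

Lemma even_periodic_derivative u du : derives u du -> evenf u -> Defs.periodic L u ->
  du 0 = 0 /\ du (L / 2) = 0.
Proof.
move=> hu eu pu.
have odd x : du (- x) = - du x.
  have h1 := derives_opp hu.
  have h2 := eq_derives h1 eu.
  by have := derives_unique h2 hu x; lra.
have per x : du (x + L) = du x.
  by have := derives_unique (eq_derives (derives_translate L hu) pu) hu x.
have E : - (L / 2) + L = L / 2 by field.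
have := odd 0; have := odd (L / 2); rewrite oppr0 -(per (- (L / 2))) E; lra.
Qed.

Lemma ae_imply (P1 P2 : R -> Prop) : (forall x, P1 x -> P2 x) ->
  {ae leb, forall x, P1 x} -> {ae leb, forall x, P2 x}.
Proof.
move=> P12 [A [mA A0 sA]]; exists A; split=> // x /= nP2.
by apply: sA => /= p1; apply: nP2; exact: P12.
Qed.

Lemma ae_forall (P : R -> Prop) : (forall x, P x) -> {ae leb, forall x, P x}.
Proof.
by move=> h; apply: aeW.
Qed.

(* The C^1 function du + pint g carries the absolutely continuous equation u'' = Q u - g. *)
Lemma H2pe_weak_equation u w Q g : continuous Q -> H2pe L u w -> L2per L g ->
  {ae leb, forall x, w x = Q x * u x - g x} ->
  exists du, [/\ derives u du, derives (fun x => du x + pint g x) (fun x => Q x * u x),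
    du 0 = 0 & du (L / 2) = 0].
Proof.
move=> cQ [pu [eu [w2 [du [hu hw]]]]] g2 aew.
have [d0 dL] := even_periodic_derivative hu eu pu.
exists du; split => //.
have cQu : continuous (fun x => Q x * u x) by apply: continuousM_fun => //; exact: derives_continuous hu.
have mQu := continuous_measurable_fun cQu.
have lg := L2per_locint g2.
have E x : du x = pint (fun x => Q x * u x) x - pint g x.
  rewrite (pint_unique hw) d0 add0r (pint_ae (g2 := fun x => Q x * u x - g x)) //.
  - by rewrite pintB //; exact: continuous_locint.
  - by case: w2.
  - by apply: measurable_funB => //; case: g2.
apply: (eq_derives (derives_pint cQu)) => x.
by rewrite E subrK.
Qed.

Variables (P : R -> R) (y dy : R -> R -> R).
Hypotheses (cP : continuous P) (Peven : forall x, P (- x) = P x).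
Hypothesis Phalf : forall x, P (L / 2 - x) = P x.
Hypothesis yE : even_family P y dy.

Let cPl l : continuous (fun x => P x - l).
Proof. by apply: continuousB_fun => //; exact: (derives_continuous (derives_cst l)). Qed.

Let Pper : Defs.periodic L P.
Proof.
move=> x; rewrite -Phalf; have -> : L / 2 - (x + L) = - (L / 2 + x) by field.
by rewrite Peven -[x]opprK Phalf.
Qed.

Let P_reflect x : P (L - x) = P x.
Proof. by rewrite addrC Pper Peven. Qed.

Let L2per0 : L2per L (fun=> 0).
Proof. by apply: continuous_L2per; [exact: (derives_continuous (derives_cst 0))|]. Qed.

Lemma kernel_multiple l u w : H2pe L u w ->
  {ae leb, forall x, - w x + P x * u x = l * u x} ->
  (forall x, u x = u 0 * y l x) /\ (u 0 != 0 -> dy l (L / 2) = 0).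
Proof.
move=> hu aew.
have aew' : {ae leb, forall x, w x = (P x - l) * u x - (fun=> 0) x}.
  by apply: ae_imply aew => x e; rewrite subr0 mulrBl -e; ring.
have [du [h1 h2 d0 dL]] := H2pe_weak_equation (@cPl l) hu L2per0 aew'.
have p0 x : pint (fun=> 0) x = 0 :> R.
  have := derives0_cst x 0 (derives_pint (derives_continuous (@derives_cst R 0))).
  by rewrite pint0.
have h3 : derives du (fun x => (P x - l) * u x).
  by apply: (eq_derives h2) => x; rewrite p0 addr0.
have H := even_family_unique cP yE h1 h3 d0.
split=> [x|u0]; first by have [] := H x.
by have [_ /eqP] := H (L / 2); rewrite dL eq_sym mulf_eq0 (negPf u0) => /eqP.
Qed.

Lemma H2pe_classical u du v : derives u du -> derives du v -> continuous v ->
  Defs.periodic L u -> evenf u -> Defs.periodic L v -> H2pe L u v.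
Proof.
move=> h1 h2 cv pu eu pv; split=> //; split=> //; split; first exact: continuous_L2per.
exists du; split=> // a b ab; rewrite Rintegral_pint //; last exact: continuous_locint.
have h3 := derivesB h2 (derives_pint cv).
have {}h3 : derives (fun x => du x - pint v x) (fun=> 0).
  by apply: (derives_eq h3) => x; rewrite subrr.
by have := derives0_cst a b h3; lra.
Qed.

Lemma kernel_exists l (c : R) : dy l (L / 2) = 0 ->
  exists w, H2pe L (fun x => c * y l x) w /\
    {ae leb, forall x, - w x + P x * (c * y l x) = l * (c * y l x)}.
Proof.
move=> dL; have [h1 h2 h3 h4] := yE l.
have ye x : y l (- x) = y l x by exact: (even_family_even cP yE Peven).
have yp x : y l (x + L) = y l x.
  have L2 : L = 2 * (L / 2) by field.
  by rewrite [in LHS]L2; exact: (even_family_periodic cP yE Peven Phalf dL).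
exists (fun x => c * ((P x - l) * y l x)); split; last first.
  by apply: ae_forall => x; ring.
apply: (H2pe_classical (derivesZ c h1) (derivesZ c h2)).
- apply: continuousM_fun; first exact: (derives_continuous (derives_cst c)).
  by apply: continuousM_fun => //; exact: derives_continuous h1.
- by move=> x; rewrite yp.
- by move=> x; rewrite ye.
- by move=> x; rewrite yp Pper.
Qed.

(** In the difference of u and its reflection about c/2 the primitives of g cancel up to a constant,
    so it solves the homogeneous equation classically, with zero data at c/2. The values c = 0 and c
    = L yield evenness and, combined, periodicity. *)
Lemma weak_solution_reflect (c : R) Q g u du : continuous Q -> measurable_fun setT g ->
  locint g -> (forall x, Q (c - x) = Q x) -> (forall x, g (c - x) = g x) ->
  derives u du -> derives (fun x => du x + pint g x) (fun x => Q x * u x) ->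
  du (c / 2) = 0 -> forall x, u (c - x) = u x.
Proof.
move=> cQ mg lg Qc gc hu hN dc x.
have hd := derivesB (derives_reflect c hu) hu.
have hN' : derives (fun x => - (du (c - x) + pint g (c - x))) (fun x => Q x * u (c - x)).
  by apply: (derives_eq (derivesN (derives_reflect c hN))) => z; rewrite opprK Qc.
have hdd : derives (fun x => - du (c - x) - du x) (fun x => Q x * (u (c - x) - u x)).
  have := derivesD (derivesB hN' hN) (derives_cst (pint g c)).
  move=> H; apply: (eq_derives (derives_eq H _)) => z; first by ring.
  by rewrite (pint_reflect z lg mg gc); ring.
have h0 := derives_cst (R := R) 0.
have h0' : derives (fun=> 0) (fun x => Q x * 0).
  by apply: (derives_eq h0) => z; rewrite mulr0.
have cc : c - c / 2 = c / 2 by field.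
have := linear_ode_unique_at (x0 := c / 2) cQ hd hdd h0 h0'.
rewrite cc dc oppr0 !subrr addr0 => /(_ erefl erefl x)[e _].
by apply/eqP; rewrite -subr_eq0 e.
Qed.

Lemma resolvent_onto l g : dy l (L / 2) != 0 -> L2pe L g ->
  exists u w, H2pe L u w /\ {ae leb, forall x, - w x + P x * u x - l * u x = g x}.
Proof.
move=> dL [g2 ge]; have [h1 h2 h3 h4] := yE l.
have lg := L2per_locint g2; have [mg [pg _]] := g2.
have cG := pint_continuous lg; have hGG := derives_pint cG.
pose Q x := P x - l.
have cQ : continuous Q := @cPl l.
(* Although g is only L^2, h = u + [pint (pint g)] satisfies h'' = Q h - Q [pint (pint g)], whose
   forcing is continuous. *)
have cF : continuous (fun x => - (Q x * pint (pint g) x)).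
  have c1 : continuous (fun x => Q x * pint (pint g) x).
    by apply: continuousM_fun => //; exact: derives_continuous hGG.
  by move=> x; apply: cvgN; exact: c1.
have [h [dh [hh hdh hh0 dh0]]] := linear_ode_exists 0 0 cQ cF.
(* The multiple of y_l that makes u'(L/2) = 0, possible because y_l'(L/2) is nonzero; u'(0) = 0
   holds for any c. *)
pose c := - (dh (L / 2) - pint g (L / 2)) / dy l (L / 2).
pose u x := h x - pint (pint g) x + c * y l x.
pose du x := dh x - pint g x + c * dy l x.
have hu : derives u du := derivesD (derivesB hh hGG) (derivesZ c h1).
have hN : derives (fun x => du x + pint g x) (fun x => Q x * u x).
  apply: (eq_derives (derives_eq (derivesD hdh (derivesZ c h2)) _)) => x.
    by rewrite /u /Q; ring.
  by rewrite /du; ring.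
have du0 : du 0 = 0 by rewrite /du dh0 pint0 h4 mulr0 subrr addr0.
have duL : du (L / 2) = 0 by rewrite /du /c divfK // subrr.
have g0 x : g (0 - x) = g x by rewrite sub0r ge.
have gL x : g (L - x) = g x by rewrite addrC pg ge.
have Q0 x : Q (0 - x) = Q x by rewrite sub0r /Q Peven.
have QL x : Q (L - x) = Q x by rewrite /Q P_reflect.
have ue x : u (- x) = u x.
  by rewrite -sub0r; apply: (weak_solution_reflect cQ mg lg Q0 g0 hu hN); rewrite mul0r.
have ur x : u (L - x) = u x by exact: (weak_solution_reflect cQ mg lg QL gL hu hN).
have up : Defs.periodic L u.
  by move=> x; rewrite addrC -[x]opprK ur ue opprK.
have cQu : continuous (fun x => Q x * u x).
  by apply: continuousM_fun => //; exact: derives_continuous hu.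
have pQu : Defs.periodic L (fun x => Q x * u x).
  by move=> x; rewrite up /Q Pper.
exists u, (fun x => Q x * u x - g x); split; last first.
  by apply: ae_forall => x; rewrite /Q; ring.
split=> //; split=> //; split; first by apply: L2perB => //; exact: continuous_L2per.
exists du; split=> // a b ab.
have lQu := continuous_locint cQu.
rewrite Rintegral_pint //; last first.
  by have := locintD lQu (locintN lg).
rewrite !pintB //.
have hD := derivesB hN (derives_pint cQu).
have {}hD : derives (fun x => du x + pint g x - pint (fun t => Q t * u t) x) (fun=> 0).
  by apply: (derives_eq hD) => x; rewrite subrr.
by have := derives0_cst a b hD; lra.
Qed.

(* With A_i = y_i (u' + G) - y_i' u, where G is a primitive of g, one has A_i' = y_i' G, and
   u is recovered from A_1 and A_2 since y_1, y_2 have Wronskian 1. *)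
Lemma weak_solution_bound l : dy l (L / 2) != 0 -> exists2 K : R, 0 <= K &
  forall u du g, locint g -> derives u du ->
    derives (fun x => du x + pint g x) (fun x => (P x - l) * u x) ->
    du 0 = 0 -> du (L / 2) = 0 ->
    forall x : R, 0 <= x <= L -> `|u x| <= K * pint (fun t => `|g t|) L.
Proof.
move=> dL; have [h1 h2 h3 h4] := yE l.
have [y2 [dy2 [k1 k2 k3 k4]]] :=
  linear_ode_exists 0 1 (@cPl l) (derives_continuous (@derives_cst R 0)).
have {}k2 : derives dy2 (fun x => (P x - l) * y2 x).
  by apply: (derives_eq k2) => x; rewrite addr0.
have wr x : y l x * dy2 x - dy l x * y2 x = 1.
  have h : derives (fun x => y l x * dy2 x - dy l x * y2 x) (fun=> 0).
    by apply: (derives_eq (derivesB (derivesM h1 k2) (derivesM h2 k1))) => z; ring.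
  by have := derives0_cst x 0 h; rewrite h3 h4 k3 k4 => ->; ring.
have [M [M0 B1 B2 B3 B4]] : exists M : R, [/\ 0 <= M,
    forall x : R, 0 <= x <= L -> `|y l x| <= M, forall x : R, 0 <= x <= L -> `|dy l x| <= M,
    forall x : R, 0 <= x <= L -> `|y2 x| <= M & forall x : R, 0 <= x <= L -> `|dy2 x| <= M].
  have [M1 ? H1] := continuous_bounded 0 L (derives_continuous h1).
  have [M2 ? H2] := continuous_bounded 0 L (derives_continuous h2).
  have [M3 ? H3] := continuous_bounded 0 L (derives_continuous k1).
  have [M4 ? H4] := continuous_bounded 0 L (derives_continuous k2).
  exists (M1 + M2 + M3 + M4); split.
  - lra.
  - by move=> x /H1; lra.
  - by move=> x /H2; lra.
  - by move=> x /H3; lra.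
  - by move=> x /H4; lra.
(* A_1 at L/2, where u' = 0, bounds u(L/2) with constant K1 after division by y_l'(L/2); A_2 at L/2
   then bounds u(0) with constant K2, which controls A_2 everywhere. *)
pose K1 := M * (1 + L) / `|dy l (L / 2)|.
have nd : 0 < `|dy l (L / 2)| by rewrite normr_gt0.
have K10 : 0 <= K1 by rewrite divr_ge0 ?mulr_ge0 //; move: L0; lra.
pose K2 := M + M * K1 + M * L.
have K20 : 0 <= K2 by rewrite /K2; have := mulr_ge0 M0 K10; have := mulr_ge0 M0 (ltW L0); lra.
exists (M * (M * L) + M * (K2 + M * L)).
  by rewrite addr_ge0 // mulr_ge0 // ?addr_ge0 // mulr_ge0 // ltW.
move=> u du g lg hu hN d0 dX.
set B := pint (fun t => `|g t|) L.
have GB x : 0 <= x <= L -> `|pint g x| <= B by move=> xL; exact: normr_pint.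
have LL : 0 <= L <= L by rewrite (ltW L0) lexx.
have B0 : 0 <= B by apply: le_trans (GB L LL).
have Xin : 0 <= L / 2 <= L by move: L0 => *; apply/andP; split; lra.
have step (v dv : R -> R) : derives v dv -> derives dv (fun x => (P x - l) * v x) ->
    (forall x : R, 0 <= x <= L -> `|dv x| <= M) ->
    forall x : R, 0 <= x <= L ->
    `|(v x * (du x + pint g x) - dv x * u x) - (v 0 * (du 0 + pint g 0) - dv 0 * u 0)| <= M * L * B.
  move=> hv hdv Mdv x /andP[x0 xL].
  have hA : derives (fun x => v x * (du x + pint g x) - dv x * u x) (fun x => dv x * pint g x).
    by apply: (derives_eq (derivesB (derivesM hv hN) (derivesM hdv hu))) => z; ring.
  have := derives_lip (M := M * B) hA x0; rewrite subr0 => H.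
  apply: (@le_trans _ _ (M * B * x)).
    apply: H => t /andP[t0 tx]; have tL : 0 <= t <= L by rewrite t0 (le_trans tx).
    by rewrite normrM; apply: ler_pM => //; [exact: Mdv|exact: GB].
  by rewrite mulrAC; apply: ler_wpM2r => //; rewrite ler_wpM2l.
have A1 x : 0 <= x <= L -> `|y l x * (du x + pint g x) - dy l x * u x| <= M * L * B.
  by move=> xL; have := step _ _ h1 h2 B2 x xL; rewrite d0 pint0 h4 addr0 mulr0 mul0r !subr0.
have A2 x : 0 <= x <= L -> `|y2 x * (du x + pint g x) - dy2 x * u x + u 0| <= M * L * B.
  by move=> xL; have := step _ _ k1 k2 B4 x xL; rewrite k3 k4 mul0r mul1r sub0r opprK.
have MB x (v : R -> R) : 0 <= x <= L -> (forall x : R, 0 <= x <= L -> `|v x| <= M) ->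
    `|v x * pint g x| <= M * B.
  by move=> xL Mv; rewrite normrM; apply: ler_pM => //; [exact: Mv|exact: GB].
have uX : `|u (L / 2)| <= K1 * B.
  have := A1 _ Xin; rewrite dX add0r => H.
  rewrite /K1 mulrAC ler_pdivlMr // mulrC -normrM.
  have -> : dy l (L / 2) * u (L / 2) = y l (L / 2) * pint g (L / 2) -
    (y l (L / 2) * pint g (L / 2) - dy l (L / 2) * u (L / 2)) by ring.
  apply: (le_trans (ler_normB _ _)); have := MB _ _ Xin B1; nra.
have u0 : `|u 0| <= K2 * B.
  have := A2 _ Xin; rewrite dX add0r => H.
  have -> : u 0 = (y2 (L / 2) * pint g (L / 2) - dy2 (L / 2) * u (L / 2) + u 0) -
    y2 (L / 2) * pint g (L / 2) + dy2 (L / 2) * u (L / 2) by ring.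
  apply: (le_trans (ler_normD _ _)).
  have : `|dy2 (L / 2) * u (L / 2)| <= M * (K1 * B).
    by rewrite normrM; apply: ler_pM => //; exact: B4.
  have := ler_normB (y2 (L / 2) * pint g (L / 2) - dy2 (L / 2) * u (L / 2) + u 0)
    (y2 (L / 2) * pint g (L / 2)).
  have := MB _ _ Xin B3; rewrite /K2; nra.
move=> x xL.
have -> : u x = y2 x * (y l x * (du x + pint g x) - dy l x * u x)
    - y l x * (y2 x * (du x + pint g x) - dy2 x * u x).
  by rewrite -[LHS]mul1r -(wr x); ring.
apply: (le_trans (ler_normB _ _)); rewrite mulrDl; apply: lerD.
  rewrite normrM -[leRHS]mulrA; apply: ler_pM => //; [exact: B3|exact: A1].
rewrite normrM -[leRHS]mulrA; apply: ler_pM => //; first exact: B1.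
have := A2 _ xL; have := ler_normB (y2 x * (du x + pint g x) - dy2 x * u x + u 0) (u 0).
rewrite addrK; nra.
Qed.

(** Cauchy-Schwarz against the constant 1, by integrating 2 (B/L) |g| <= g^2 + (B/L)^2 over a
    period, with B the integral of |g|. *)
Lemma sqr_pint_norm g : L2per L g ->
  (((pint (fun t => `|g t|) L) ^+ 2)%:E <= L%:E * nrm2 L g)%E.
Proof.
move=> g2; have lg := L2per_locint g2; have [mg pg ig] := (L2perP g).1 g2.
set B := pint _ L.
pose S := \int[leb]_(x in `[0, L]) (g x ^+ 2).
have -> : nrm2 L g = S%:E.
  rewrite /S /Rintegral fineK //; exact: (integrable_fin_num _ ig).
have BE : B = \int[leb]_(x in `[0, L]) `|g x| by rewrite /B /pint ltW.
have i1 : leb.-integrable `[0, L] (EFin \o (fun x => 2 * (B / L) * `|g x|)).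
  exact: (locintZ _ (locint_norm lg)).
have c2 : leb.-integrable `[0, L] (EFin \o (fun=> (B / L) ^+ 2)).
  exact: (continuous_locint (derives_continuous (derives_cst _))).
have i2 : leb.-integrable `[0, L] (EFin \o (fun x => g x ^+ 2 + (B / L) ^+ 2)).
  have := integrableD _ ig c2 => /(_ (measurable_itv _)); exact: eq_integrable.
have : \int[leb]_(x in `[0, L]) (2 * (B / L) * `|g x|) <=
    \int[leb]_(x in `[0, L]) (g x ^+ 2 + (B / L) ^+ 2).
  apply: le_Rintegral => // x _; rewrite -(@real_normK _ (g x)) ?num_real //.
  by have := sqr_ge0 (`|g x| - B / L); rewrite !expr2; nra.
rewrite RintegralZl //; last exact: locint_norm lg 0 L.
rewrite RintegralD // -BE -/S Rintegral_cst //= measure_period /= => H.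
rewrite -EFinM lee_fin.
have E : L * (S + (B / L) ^+ 2 * L - 2 * (B / L) * B) = L * S - B ^+ 2 by field; rewrite gt_eqF.
have : 0 <= L * S - B ^+ 2 by rewrite -E mulr_ge0 ?(ltW L0) // subr_ge0.
by rewrite subr_ge0.
Qed.

Lemma resolvent_bounded l : dy l (L / 2) != 0 -> exists2 C : R, 0 <= C &
  forall u w, H2pe L u w ->
    (nrm2 L u <= C%:E * nrm2 L (fun x => (- w x + P x * u x - l * u x)%R))%E.
Proof.
move=> dL; have [K K0 HK] := weak_solution_bound dL.
(* One factor L comes from integrating the squared supremum bound over a period, the other from
   Cauchy-Schwarz. *)
exists (L * K ^+ 2 * L); first by rewrite !mulr_ge0 ?sqr_ge0 // ltW.
move=> u w hu; set g := fun x => _.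
have [pu [eu [w2 [du0 [hu0 _]]]]] := hu.
have g2 : L2per L g.
  have h : L2per L (fun x => (P x - l) * u x).
    apply: continuous_L2per; first by apply: continuousM_fun => //; exact: derives_continuous hu0.
    by move=> x; rewrite pu Pper.
  have := L2perB h w2; congr (L2per L _); apply/funext => x; rewrite /g; ring.
have aew : {ae leb, forall x, w x = (P x - l) * u x - g x}.
  by apply: ae_forall => x; rewrite /g; ring.
have [du [h1 h2 d0 dX]] := H2pe_weak_equation (@cPl l) hu g2 aew.
have lg := L2per_locint g2.
have ub := HK u du g lg h1 h2 d0 dX.
set B := pint _ L in ub.
have mu := continuous_measurable_fun (derives_continuous h1).
apply: (@le_trans _ _ (L * (K * B) ^+ 2)%:E).
  apply: (@le_trans _ _ (\int[leb]_(x in `[0%R, L]) (cst ((K * B) ^+ 2)%:E x)))%E.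
    apply: ge0_le_integral => //.
    - by move=> x _; rewrite lee_fin sqr_ge0.
    - by apply/measurable_EFinP; apply: measurable_funTS; exact: measurable_funX.
    - move=> x; rewrite /= in_itv /= => /ub H; rewrite lee_fin -(@real_normK _ (u x)) ?num_real //.
      by apply: lerXn2r; rewrite ?nnegrE // (le_trans _ H).
  by rewrite integral_cst //= measure_period -EFinM mulrC.
have := sqr_pint_norm g2; rewrite -/B => H.
have -> : (L * (K * B) ^+ 2)%:E = ((L * K ^+ 2)%:E * (B ^+ 2)%:E)%E.
  by rewrite -EFinM exprMn mulrA.
rewrite (EFinM (L * K ^+ 2)) -muleA; apply: lee_wpmul2l => //.
by rewrite lee_fin mulr_ge0 ?sqr_ge0 // ltW.
Qed.

End PeriodicL2.

(** * Jacobi elliptic functions and the cnoidal wave *)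

Section Cnoidal.
Variable R : realType.

Lemma derives_sqrt (f df : R -> R) : (forall x, 0 < f x) -> derives f df ->
  derives (fun x => Num.sqrt (f x)) (fun x => df x / (2 * Num.sqrt (f x))).
Proof.
move=> f0 hf x; have h1 := hf x; have h2 := is_derive1_sqrt (f0 x).
by apply: (is_derive_eq (is_derive1_comp h2 h1)); rewrite mulrC.
Qed.

Lemma derives_inv (f df : R -> R) : (forall x, f x != 0) -> derives f df ->
  derives (fun x => (f x)^-1) (fun x => - (f x) ^- 2 * df x).
Proof. by move=> f0 hf x; have h1 := hf x; apply: is_deriveV. Qed.

Variables (L k : R).
Hypotheses (L0 : 0 < L) (k01 : 0 < k < 1).

Let k2 : 0 < k ^+ 2 < 1.
Proof. by move: k01 => /andP[? ?]; rewrite exprn_gt0 //= expr_lt1 // ltW. Qed.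

Definition delta (t : R) : R := Num.sqrt (1 - k ^+ 2 * sin t ^+ 2).

Lemma delta_arg_gt0 t : 0 < 1 - k ^+ 2 * sin t ^+ 2.
Proof.
have := cos2Dsin2 t; have := sqr_ge0 (cos t); have := sqr_ge0 (sin t).
move: k2 => /andP[? ?]; nra.
Qed.

Lemma delta_gt0 t : 0 < delta t.
Proof. by rewrite sqrtr_gt0 delta_arg_gt0. Qed.

Lemma sqr_delta t : delta t ^+ 2 = 1 - k ^+ 2 * sin t ^+ 2.
Proof. by rewrite sqr_sqrtr // ltW // delta_arg_gt0. Qed.

Lemma derives_sin : derives (@sin R) cos.
Proof. exact: is_derive_sin. Qed.

Lemma derives_cos : derives (@cos R) (fun x => - sin x).
Proof. exact: is_derive_cos. Qed.

Lemma derives_delta : derives delta (fun t => - k ^+ 2 * sin t * cos t / delta t).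
Proof.
have h := derivesB (derives_cst 1) (derivesZ (k ^+ 2) (derivesX 2 derives_sin)).
apply: (derives_eq (derives_sqrt delta_arg_gt0 h)) => x /=.
by rewrite -/(delta x); field; rewrite gt_eqF // delta_gt0.
Qed.

Lemma derives_ellF : derives (fun t => ellF t k) (fun t => 1 / delta t).
Proof.
have c : continuous (fun t => 1 / delta t).
  have h := derives_inv (fun t => lt0r_neq0 (delta_gt0 t)) derives_delta.
  have := derives_continuous h; under eq_fun do rewrite -div1r; exact.
exact: (eq_derives (derives_pint c)).
Qed.

Lemma ellF0 : ellF 0 k = 0.
Proof. exact: (pint0 (fun t => 1 / delta t)). Qed.

Lemma ellF_incr (s t : R) : s < t -> ellF s k < ellF t k.
Proof.
by move=> st; apply: (derives_incr derives_ellF st) => x _; rewrite divr_gt0 // delta_gt0.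
Qed.

Lemma ellF_inj s t : ellF s k = ellF t k -> s = t.
Proof.
move=> e; case: (ltgtP s t) => // /ellF_incr; by rewrite e ltxx.
Qed.

(** The integrand is at least 1. This growth makes [ellF] onto, so that the amplitude [jam] is its
    inverse. *)
Lemma ellF_expanding (s t : R) : s <= t -> t - s <= ellF t k - ellF s k.
Proof.
move=> st; have h := derivesB derives_ellF (@derives_id R).
have := derives_nondecr h st => H.
suff : ellF s k - s <= ellF t k - t by lra.
apply: H => x _; rewrite subr_ge0 ler_pdivlMr ?delta_gt0 // mul1r.
rewrite -[leRHS]sqrtr1 ler_sqrt // lerBlDr lerDl.
by rewrite mulr_ge0 ?sqr_ge0.
Qed.

Lemma ellF_surj u : exists t, ellF t k = u.
Proof.
have [|||t _ e] := continuous_IVT0 (f := fun t => ellF t k - u) (a := - `|u|) (b := `|u|).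
- exact: (derives_continuous (derivesB derives_ellF (derives_cst u))).
- by rewrite (le_trans _ (normr_ge0 u)) // oppr_le0.
- have h1 := ellF_expanding (normr_ge0 u).
  have h2 : - `|u| <= 0 by rewrite oppr_le0.
  have {}h2 := ellF_expanding h2.
  rewrite ellF0 in h1 h2.
  have := ler_norm u; have := ler_norm (- u); rewrite normrN => ? ?.
  by rewrite mulr_le0_ge0 //; lra.
- by exists t; apply/eqP; rewrite -subr_eq0 e.
Qed.

(** By surjectivity [xget] always finds a solution and never falls back on its default 0. *)
Lemma jamK u : ellF (jam u k) k = u.
Proof. by rewrite /jam; apply: (@xgetPex _ _ [set t | ellF t k = u]); exact: ellF_surj. Qed.

Lemma ellFK t : jam (ellF t k) k = t.
Proof. by apply: ellF_inj; rewrite jamK. Qed.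

Lemma derives_jam : derives (fun u => jam u k) (fun u => delta (jam u k)).
Proof.
suff H (u : R) : is_derive u 1 (fun u => jam u k) (delta (jam u k)) by exact: H.
have d0 := delta_gt0 (jam u k).
have := @is_derive_inverse R (fun t => ellF t k) (fun u => jam u k) (1 / delta (jam u k)) (jam u k).
rewrite jamK div1r invrK; apply.
- by exists 1 => //= t _; rewrite ellFK.
- by exists 1 => //= t _; exact: (derives_continuous derives_ellF).
- by rewrite -div1r; exact: derives_ellF.
- by rewrite invr_eq0 gt_eqF.
Qed.

Let sn u := jsn u k.
Let cn u := jcn u k.
Let dn u := delta (jam u k).

Lemma derives_sn : derives sn (fun u => cn u * dn u).
Proof. exact: (derives_comp derives_sin derives_jam). Qed.

Lemma derives_cn : derives cn (fun u => - sn u * dn u).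
Proof. exact: (derives_comp derives_cos derives_jam). Qed.

Lemma derives_dn : derives dn (fun u => - k ^+ 2 * sn u * cn u).
Proof.
apply: (derives_eq (derives_comp derives_delta derives_jam)) => u.
by rewrite divfK // gt_eqF // delta_gt0.
Qed.

Local Notation s := (s_ k).
Local Notation q := (q_ k).
Local Notation b := (b_ L k).
Local Notation a := (a_ L k).

Lemma s_sqr : s ^+ 2 = k ^+ 4 - k ^+ 2 + 1.
Proof.
rewrite /s_ sqr_sqrtr //; move: k2 => /andP[? ?].
have -> : k ^+ 4 = k ^+ 2 * k ^+ 2 by rewrite -exprD.
by nra.
Qed.

Lemma s_gt0 : 0 < s.
Proof.
rewrite /s_ sqrtr_gt0; move: k2 => /andP[? ?].
have -> : k ^+ 4 = k ^+ 2 * k ^+ 2 by rewrite -exprD.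
by nra.
Qed.

Lemma q_lt0 : q < 0.
Proof. by have := s_gt0; rewrite /q_; move: k2 => /andP[? ?]; lra. Qed.

Lemma ellK_gt0 : 0 < ellK k.
Proof. by rewrite /ellK -ellF0; apply: ellF_incr; rewrite divr_gt0 // pi_gt0. Qed.

Lemma b_gt0 : 0 < b.
Proof. by rewrite /b_ divr_gt0 // mulr_gt0 // ellK_gt0. Qed.

(** Since s^2 = k^4 - k^2 + 1, the numerator contains the factor - q s, and q cancels. *)
Lemma omega_E : omega_ L k = b ^+ 2 * s.
Proof.
have E : (1 - k ^+ 2) * s + k ^+ 4 - k ^+ 2 + 1 = - q * s.
  have -> : (1 - k ^+ 2) * s + k ^+ 4 - k ^+ 2 + 1 = (1 - k ^+ 2) * s + (k ^+ 4 - k ^+ 2 + 1) by ring.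
  by rewrite -s_sqr /q_; ring.
have q0 := q_lt0.
rewrite /omega_ E -/(q_ k) /b_; field.
by rewrite (lt_eqF q0) (gt_eqF L0).
Qed.

Lemma omega_gt0 : 0 < omega_ L k.
Proof. by rewrite omega_E mulr_gt0 ?exprn_gt0 ?b_gt0 ?s_gt0. Qed.

Let amp := q * (- k ^+ 2 - 1 - s).

Let ampE : amp = 2 * s + 2 - k ^+ 2.
Proof.
have -> : amp = s ^+ 2 + 2 * s + 1 - k ^+ 4 by rewrite /amp /q_; ring.
by rewrite s_sqr; ring.
Qed.

Let amp_gt0 : 0 < amp.
Proof. by rewrite ampE; have := s_gt0; move: k2 => /andP[? ?]; lra. Qed.

Let rad_gt0 : 0 < ellK k ^+ 2 * q * (- k ^+ 2 - 1 - s) * L ^+ 2.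
Proof.
have -> : ellK k ^+ 2 * q * (- k ^+ 2 - 1 - s) * L ^+ 2 = ellK k ^+ 2 * amp * L ^+ 2.
  by rewrite /amp; ring.
by apply: mulr_gt0; [apply: mulr_gt0|]; rewrite ?exprn_gt0 ?ellK_gt0.
Qed.

Lemma a_gt0 : 0 < a.
Proof. by rewrite /a_ -/(q_ k) divr_gt0 // mulr_gt0 // !sqrtr_gt0; exact: rad_gt0. Qed.

Lemma a_pow4 : a ^+ 4 = b ^+ 2 * (2 * s + 2 - k ^+ 2).
Proof.
rewrite -ampE /a_ -/(q_ k); set Z := _ * L ^+ 2.
have Z0 : 0 <= Z by apply: ltW; exact: rad_gt0.
have E : Num.sqrt (Num.sqrt Z) ^+ 4 = Z.
  by rewrite (exprM _ 2 2) sqr_sqrtr ?sqrtr_ge0 // sqr_sqrtr.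
rewrite exprMn exprVn exprMn E /Z /amp /b_; field.
by rewrite (gt_eqF L0).
Qed.

Let I u := (Num.sqrt (1 - q * sn u ^+ 2))^-1.

Let den_gt0 u : 0 < 1 - q * sn u ^+ 2.
Proof. by have := sqr_ge0 (sn u); have := q_lt0; nra. Qed.

Let I_gt0 u : 0 < I u.
Proof. by rewrite invr_gt0 sqrtr_gt0. Qed.

Let I_sqr u : I u ^+ 2 * (1 - q * sn u ^+ 2) = 1.
Proof.
rewrite /I exprVn sqr_sqrtr; last exact: ltW.
by rewrite mulVf // gt_eqF.
Qed.

Let sn2 u : sn u ^+ 2 = 1 - cn u ^+ 2.
Proof. by have := cos2Dsin2 (jam u k); rewrite /sn /cn /jsn /jcn; lra. Qed.

Let derives_I : derives I (fun u => q * sn u * cn u * dn u * I u ^+ 3).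
Proof.
have h := derivesB (derives_cst 1) (derivesZ q (derivesX 2 derives_sn)).
have hs := derives_sqrt den_gt0 h.
have n0 u : Num.sqrt (1 - q * sn u ^+ 2) != 0 by rewrite gt_eqF // sqrtr_gt0.
apply: (derives_eq (derives_inv n0 hs)) => u /=.
by rewrite /I; field.
Qed.

Lemma derives_cnoidal : derives (cnoidal L k)
  (fun x => a * b * (q - 1) * (sn (b * x) * dn (b * x) * I (b * x) ^+ 3)).
Proof.
have h := derivesM derives_cn derives_I.
have {}h : derives (fun u => cn u * I u) (fun u => (q - 1) * (sn u * dn u * I u ^+ 3)).
  apply: (derives_eq h) => u.
  (* Raising I to I^3 and writing sn^2 = 1 - cn^2 collapses the two terms of the derivative into one
     product. *)
  have E : I u = I u ^+ 3 * (1 - q * sn u ^+ 2) by rewrite exprS -mulrA I_sqr mulr1.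
  by rewrite [in X in X + _]E sn2; ring.
have h2 := derivesZ a (derives_comp h (derivesZ b (@derives_id R))).
apply: (eq_derives (derives_eq h2 _)) => x; first by ring.
by rewrite /cnoidal mulrA.
Qed.

Lemma cnoidal_ode : derives
  (fun x => a * b * (q - 1) * (sn (b * x) * dn (b * x) * I (b * x) ^+ 3))
  (fun x => omega_ L k * cnoidal L k x - cnoidal L k x ^+ 5).
Proof.
have h := derivesM (derivesM derives_sn derives_dn) (derivesX 3 derives_I).
have h2 := derivesZ (a * b * (q - 1)) (derives_comp h (derivesZ b (@derives_id R))).
apply: (derives_eq h2) => x; rewrite /= mulr1.
have -> : cnoidal L k x = a * (cn (b * x) * I (b * x)) by rewrite /cnoidal mulrA.
move: (b * x) => u.
have dn2 : dn u * dn u = 1 - k ^+ 2 * sn u ^+ 2 by rewrite -expr2 sqr_delta.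
have i1 := I_sqr u.
(* All powers of I are raised to I^5, which leaves the polynomial identity [P] in sn^2. [C0], [C1],
   [C2] match its coefficients; only the top one needs the value of s^2. *)
have I3 : I u ^+ 3 = I u ^+ 5 * (1 - q * sn u ^+ 2).
  by rewrite (exprD _ 3 2) -mulrA i1 mulr1.
have I1 : I u = I u ^+ 5 * (1 - q * sn u ^+ 2) ^+ 2.
  by rewrite (exprS _ 4) (exprM _ 2 2) -mulrA -exprMn i1 expr1n mulr1.
have cn4 : cn u ^+ 5 = cn u * (1 - sn u ^+ 2) ^+ 2.
  by rewrite sn2 opprB addrCA subrr addr0 exprS -exprM.
have C1 : (q - 1) * (2 * q - 2 * k ^+ 2) = - 2 * q * s + 2 * (2 * s + 2 - k ^+ 2).
  by rewrite /q_; ring.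
have C2 : - ((q - 1) * k ^+ 2 * q) = s * q ^+ 2 - (2 * s + 2 - k ^+ 2).
  apply/eqP; rewrite eq_sym -subr_eq0; apply/eqP.
  have -> : s * q ^+ 2 - (2 * s + 2 - k ^+ 2) - - ((q - 1) * k ^+ 2 * q) =
    (s + 2 - k ^+ 2) * (s ^+ 2 - (k ^+ 4 - k ^+ 2 + 1)) by rewrite /q_; ring.
  by rewrite s_sqr subrr mulr0.
have C0 : q - 1 = s - (2 * s + 2 - k ^+ 2) by rewrite /q_; ring.
have P : (q - 1) * ((1 - k ^+ 2 * sn u ^+ 2) * (1 - q * sn u ^+ 2)
    - k ^+ 2 * sn u ^+ 2 * (1 - q * sn u ^+ 2) + 3 * q * sn u ^+ 2 * (1 - k ^+ 2 * sn u ^+ 2))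
    = s * (1 - q * sn u ^+ 2) ^+ 2 - (2 * s + 2 - k ^+ 2) * (1 - sn u ^+ 2) ^+ 2.
  transitivity ((q - 1) + (q - 1) * (2 * q - 2 * k ^+ 2) * sn u ^+ 2
    + - ((q - 1) * k ^+ 2 * q) * sn u ^+ 4); first by ring.
  by rewrite C1 C2 C0; ring.
have -> : (cn u * dn u * dn u + sn u * (- k ^+ 2 * sn u * cn u)) * I u ^+ 3 +
    sn u * dn u * (3 * I u ^+ 2 * (q * sn u * cn u * dn u * I u ^+ 3)) =
    cn u * ((dn u * dn u - k ^+ 2 * sn u ^+ 2) * I u ^+ 3 + 3 * q * sn u ^+ 2 * (dn u * dn u) * I u ^+ 5).
  by ring.
rewrite dn2 I3.
have -> : omega_ L k * (a * (cn u * I u)) - (a * (cn u * I u)) ^+ 5 =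
   a * cn u * I u ^+ 5 * b ^+ 2 * (s * (1 - q * sn u ^+ 2) ^+ 2 - (2 * s + 2 - k ^+ 2) * (1 - sn u ^+ 2) ^+ 2).
  have -> : (a * (cn u * I u)) ^+ 5 = a ^+ 4 * a * cn u ^+ 5 * I u ^+ 5 by ring.
  rewrite cn4 a_pow4 omega_E.
  have -> : b ^+ 2 * s * (a * (cn u * I u)) = b ^+ 2 * s * a * cn u * I u by ring.
  by rewrite {1}I1; ring.
by rewrite -P; ring.
Qed.

(** At x = L/4 the argument b x is K(k), so the amplitude is pi/2 and cn vanishes. Before that the
    amplitude lies in (0, pi/2), so sn > 0 and phi' has the sign of q - 1. *)
Lemma cnoidal_profile : exists dphi, [/\ derives (cnoidal L k) dphi,
  derives dphi (fun x => omega_ L k * cnoidal L k x - cnoidal L k x ^+ 5),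
  dphi 0 = 0, cnoidal L k (L / 4) = 0 & forall x : R, 0 < x <= L / 4 -> dphi x < 0].
Proof.
exists (fun x => a * b * (q - 1) * (sn (b * x) * dn (b * x) * I (b * x) ^+ 3)).
have bT : b * (L / 4) = ellF (pi / 2) k.
  by rewrite /b_ -/(ellK k); field; rewrite gt_eqF.
have j0 : jam 0 k = 0 by rewrite -[X in jam X k]ellF0 ellFK.
split.
- exact: derives_cnoidal.
- exact: cnoidal_ode.
- by rewrite mulr0 /sn /jsn j0 sin0 !mul0r mulr0.
- by rewrite /cnoidal bT /jcn ellFK cos_pihalf mulr0 mul0r.
move=> x /andP[x0 xT].
have bx0 : 0 < b * x by rewrite mulr_gt0 // b_gt0.
have bxT : b * x <= ellF (pi / 2) k by rewrite -bT ler_pM2l // b_gt0.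
have j1 : 0 < jam (b * x) k.
  rewrite ltNge; apply/negP; rewrite le_eqVlt => /predU1P[e|/ellF_incr].
    by move: bx0; rewrite -(jamK (b * x)) e ellF0 ltxx.
  by rewrite jamK ellF0 => /(lt_trans bx0); rewrite ltxx.
have j2 : jam (b * x) k <= pi / 2.
  rewrite leNgt; apply/negP => /ellF_incr; rewrite jamK => /lt_le_trans/(_ bxT).
  by rewrite ltxx.
have sn0 : 0 < sn (b * x).
  rewrite /sn /jsn sin_gt0_pi // j1 (le_lt_trans j2) //.
  by have := pi_gt0 R; lra.
rewrite pmulr_llt0; last by rewrite !mulr_gt0 ?exprn_gt0 // /dn delta_gt0.
rewrite pmulr_rlt0; last exact: mulr_gt0 a_gt0 b_gt0.
by have := q_lt0; lra.
Qed.

End Cnoidal.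

(** * From the two components to the spectrum of the diagonal operator *)

Section Spectrum.
Variable R : realType.
Variables (L om : R) (phi : R -> R).
Hypothesis L0 : 0 < L.
Let P1 x := om - 5 * phi x ^+ 4.
Let P2 x := om - phi x ^+ 4.
Hypotheses (cP1 : continuous P1) (cP2 : continuous P2).
Hypotheses (even1 : forall x, P1 (- x) = P1 x) (even2 : forall x, P2 (- x) = P2 x).
Hypotheses (half1 : forall x, P1 (L / 2 - x) = P1 x) (half2 : forall x, P2 (L / 2 - x) = P2 x).
Variables y dy z dz : R -> R -> R.
Hypotheses (yE : even_family P1 y dy) (zE : even_family P2 z dz).

(** The components decouple; this description of the kernel yields both the eigenvalues and their
    simplicity. *)
Lemma eigvecP l (u1 u2 : R -> R) : eigvec L om phi l u1 u2 <->
  exists c1 c2 : R, [/\ u1 = (fun x => c1 * y l x), u2 = (fun x => c2 * z l x),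
    c1 = 0 \/ dy l (L / 2) = 0 & c2 = 0 \/ dz l (L / 2) = 0].
Proof.
split=> [[w1 [w2 [h1 [h2 [e1 e2]]]]]|[c1 [c2 [-> -> d1 d2]]]].
  have [k1 k1'] := kernel_multiple L0 cP1 yE h1 e1.
  have [k2 k2'] := kernel_multiple L0 cP2 zE h2 e2.
  exists (u1 0), (u2 0); split; [exact/funext|exact/funext| |].
  - by case: (eqVneq (u1 0) 0) => [->|/k1']; [left|right].
  - by case: (eqVneq (u2 0) 0) => [->|/k2']; [left|right].
have zero (P : R -> R) v (c : R) : c = 0 -> exists w, H2pe L (fun x => c * v x) w /\
    {ae lebesgue_measure, forall x, - w x + P x * (c * v x) = l * (c * v x)}.
  move=> ->; exists (fun=> 0); split; last by apply: ae_forall => x; ring.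
  have -> : (fun x => 0 * v x) = (fun=> 0) by apply/funext => x; rewrite mul0r.
  apply: (H2pe_classical (derives_cst 0) (derives_cst 0)) => //.
  exact: (derives_continuous (derives_cst 0)).
have [w1 [h1 e1]] : exists w, H2pe L (fun x => c1 * y l x) w /\
    {ae lebesgue_measure, forall x, - w x + P1 x * (c1 * y l x) = l * (c1 * y l x)}.
  by case: d1 => [|d1]; [exact: zero|exact: kernel_exists].
have [w2 [h2 e2]] : exists w, H2pe L (fun x => c2 * z l x) w /\
    {ae lebesgue_measure, forall x, - w x + P2 x * (c2 * z l x) = l * (c2 * z l x)}.
  by case: d2 => [|d2]; [exact: zero|exact: kernel_exists].
by exists w1, w2.
Qed.

Let y_neq0 l (c : R) : (fun x => c * y l x) = (fun=> 0) -> c = 0.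
Proof. by have [_ _ y0 _] := yE l; move=> /(congr1 (@^~ 0)); rewrite y0 mulr1. Qed.

Let z_neq0 l (c : R) : (fun x => c * z l x) = (fun=> 0) -> c = 0.
Proof. by have [_ _ z0 _] := zE l; move=> /(congr1 (@^~ 0)); rewrite z0 mulr1. Qed.

Let fun0 (v : R -> R) : (fun x => 0 * v x) = (fun=> 0).
Proof. by apply/funext => x; rewrite mul0r. Qed.

Lemma simple_eig_first l : dy l (L / 2) = 0 -> dz l (L / 2) != 0 ->
  simple_eig L om phi l.
Proof.
move=> d1 d2; exists (y l), (fun=> 0); split; [|split].
- apply/eigvecP; exists 1, 0; split; [|by rewrite fun0|by right|by left].
  by apply/funext => x; rewrite mul1r.
- case=> y0 _; have [_ _ + _] := yE l; rewrite y0 => /eqP.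
  by rewrite eq_sym oner_eq0.
- move=> u1 u2 /eigvecP[c1 [c2 [-> -> _]]] [->|/eqP]; last by rewrite (negPf d2).
  exists c1; split=> //; by apply/funext => x; rewrite mul0r mulr0.
Qed.

(** The factor c allows the eigenfunction at 0 to be phi = a z_0 itself instead of the normalised
    z_0. *)
Lemma simple_eig_second l (c : R) : c != 0 -> dy l (L / 2) != 0 -> dz l (L / 2) = 0 ->
  simple_eig_with L om phi l (fun=> 0) (fun x => c * z l x).
Proof.
move=> c0 d1 d2; split; [|split].
- by apply/eigvecP; exists 0, c; split; [by rewrite fun0|by []|by left|by right].
- by case=> _ /z_neq0/eqP; rewrite (negPf c0).
- move=> u1 u2 /eigvecP[c1 [c2 [-> -> [->|/eqP]]]]; last by rewrite (negPf d1).
  move=> _; exists (c2 / c); split; apply/funext => x; first by rewrite mul0r mulr0.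
  by rewrite mulrA divfK.
Qed.

Lemma is_eigenvalueP l :
  is_eigenvalue L om phi l <-> dy l (L / 2) = 0 \/ dz l (L / 2) = 0.
Proof.
split=> [[u1 [u2 [/eigvecP[c1 [c2 [-> -> d1 d2]]] n0]]]|].
  case: d1 => [c10|]; [|by left].
  case: d2 => [c20|]; [|by right].
  by case: n0; rewrite c10 c20 !fun0.
case=> d.
  exists (fun x => 1 * y l x), (fun x => 0 * z l x); split.
    by apply/eigvecP; exists 1, 0; split=> //; [right|left].
  by case=> /y_neq0/eqP; rewrite oner_eq0.
exists (fun x => 0 * y l x), (fun x => 1 * z l x); split.
  by apply/eigvecP; exists 0, 1; split=> //; [left|right].
by case=> _ /z_neq0/eqP; rewrite oner_eq0.
Qed.

Lemma resolvent_intro l : dy l (L / 2) != 0 -> dz l (L / 2) != 0 -> resolvent L om phi l.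
Proof.
move=> d1 d2; split.
  move=> g1 g2 /(resolvent_onto L0 cP1 even1 half1 yE d1)[u1 [w1 [h1 e1]]].
  move=> /(resolvent_onto L0 cP2 even2 half2 zE d2)[u2 [w2 [h2 e2]]].
  by exists u1, w1, u2, w2.
have [C1 C10 H1] := resolvent_bounded L0 cP1 even1 half1 yE d1.
have [C2 C20 H2] := resolvent_bounded L0 cP2 even2 half2 zE d2.
exists (C1 + C2) => u1 w1 u2 w2 /H1 B1 /H2 B2.
set n1 := nrm2 L (fun x => _ - _) in B1 *; set n2 := nrm2 L (fun x => _ - _) in B2 *.
have n10 : (0 <= n1)%E by apply: integral_ge0 => x _; rewrite lee_fin sqr_ge0.
have n20 : (0 <= n2)%E by apply: integral_ge0 => x _; rewrite lee_fin sqr_ge0.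
rewrite ge0_muleDr //; apply: leeD.
  by apply: (le_trans B1); apply: lee_wpmul2r => //; rewrite lee_fin lerDl.
by apply: (le_trans B2); apply: lee_wpmul2r => //; rewrite lee_fin lerDr.
Qed.

Lemma spectrum_eigenvalue l :
  spectrum L om phi l -> dy l (L / 2) = 0 \/ dz l (L / 2) = 0.
Proof.
move=> sp; case: (eqVneq (dy l (L / 2)) 0) => [|d1]; [by left|].
case: (eqVneq (dz l (L / 2)) 0) => [|d2]; [by right|].
by case: sp; exact: resolvent_intro.
Qed.

Lemma spectrum_discrete l : exists e : R, 0 < e /\
  forall m, spectrum L om phi m -> `|m - l| < e -> m = l.
Proof.
have X0 : 0 < L / 2 by rewrite divr_gt0.
have iso V (v dv : R -> R -> R) : continuous V -> even_family V v dv ->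
    exists2 e : R, 0 < e & forall m, dv m (L / 2) = 0 -> `|m - l| < e -> m = l.
  move=> cV vE; case: (eqVneq (dv l (L / 2)) 0) => [dl|dl].
    have [e e0 H] := even_family_isolated cV vE l X0.
    by exists e => // m dm; exact: H.
  (* Here l is no eigenvalue of this component, and continuity in l keeps the derivative at L/2
     nonzero nearby. *)
  have n0 : 0 < `|dv l (L / 2)| by rewrite normr_gt0.
  have [e e0 H] := even_family_unif cV vE l (ltW X0) n0.
  exists e => // m dm ml; have XX : 0 <= L / 2 <= L / 2 by rewrite (ltW X0) lexx.
  by have [_] := H m ml _ XX; rewrite dm sub0r normrN ltxx.
have [e1 e10 H1] := iso _ _ _ cP1 yE; have [e2 e20 H2] := iso _ _ _ cP2 zE.
exists (Num.min e1 e2); split; first by rewrite lt_min e10.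
move=> m /spectrum_eigenvalue sp; rewrite lt_min => /andP[m1 m2].
by case: sp => [/H1|/H2]; exact.
Qed.

End Spectrum.

Theorem theorem4 (R : realType) (L om k : R) :
  0 < L -> 4 * pi ^+ 2 / L ^+ 2 < om ->
  0 < k < 1 -> omega_ L k = om ->
  let phi := cnoidal L k in
  (exists l1 l2 l3 : R,
     l1 < l2 /\ l2 < l3 /\ l3 < 0 /\
     (forall l, (is_eigenvalue L om phi l /\ l < 0) <-> (l = l1 \/ l = l2 \/ l = l3)) /\
     simple_eig L om phi l1 /\ simple_eig L om phi l2 /\ simple_eig L om phi l3) /\
  simple_eig_with L om phi 0 (fun _ => 0) phi /\
  (forall l, spectrum L om phi l -> is_eigenvalue L om phi l) /\
  (forall l, spectrum L om phi l ->
     exists e : R, 0 < e /\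
       forall m, spectrum L om phi m -> `|m - l| < e -> m = l).
Proof.
move=> L0 _ k01 omE phi.
have [dphi [hphi hdphi dphi0 phiT dneg]] := cnoidal_profile L0 k01.
rewrite -/phi in hphi hdphi phiT.
have om0 := omega_gt0 L0 k01.
rewrite omE in om0 hdphi.
have T0 : 0 < L / 4 by rewrite divr_gt0.
have TL : 2 * (L / 4) = L / 2 by field.
pose P1 x := om - 5 * phi x ^+ 4; pose P2 x := om - phi x ^+ 4.
have cP1 : continuous P1 := potential1_continuous hphi.
have cP2 : continuous P2 := potential2_continuous hphi.
have ev1 : forall x, P1 (- x) = P1 x := potential1_even hphi hdphi dphi0.
have ev2 : forall x, P2 (- x) = P2 x := potential2_even hphi hdphi dphi0.
have hf1 : forall x, P1 (2 * (L / 4) - x) = P1 x := potential1_reflect hphi hdphi phiT.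
have hf2 : forall x, P2 (2 * (L / 4) - x) = P2 x := potential2_reflect hphi hdphi phiT.
have [y [dy yE]] := even_family_exists cP1; have [z [dz zE]] := even_family_exists cP2.
have dyL l := even_family_half_period cP1 yE l hf1.
have dzL l := even_family_half_period cP2 zE l hf2.
rewrite TL in hf1 hf2 dyL dzL.
have a0 := profile0_gt0 T0 hphi phiT dneg.
have aom := profile_amplitude T0 hphi hdphi dphi0 phiT dneg.
have [mu0 [mu1 [m01 m1L dm0 ym1 mu_unique]]] := sturm1 T0 om0 hphi hdphi dphi0 phiT dneg yE.
have [nu [nuL nu0 dnu nu_unique]] := sturm2 T0 om0 hphi hdphi dphi0 phiT dneg zE.
have zphi := sturm2_zero hphi hdphi dphi0 zE.
set a := phi 0 in a0 aom m1L nuL zphi.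
have m1nu : mu1 < nu.
  apply: le_lt_trans m1L (le_lt_trans _ nuL); lra.
have m10 : mu1 < 0 := lt_trans m1nu nu0.
have m00 : mu0 < 0 := lt_trans m01 m10.
have dy0L : dy mu0 (L / 2) = 0 by apply/dyL; right.
have dy1L : dy mu1 (L / 2) = 0 by apply/dyL; left.
have dznuL : dz nu (L / 2) = 0 by apply/dzL; right.
(* Including l = 0 here excludes 0 from the spectrum of the first component; for the second, 0 is an
   eigenvalue and only l < 0 is claimed. *)
have dyneg l : l <= 0 -> dy l (L / 2) = 0 -> l = mu0 \/ l = mu1.
  by move=> l0 /dyL[] h; have [h1 h2] := mu_unique l l0; [right|left]; auto.
have dzneg l : l < 0 -> dz l (L / 2) = 0 -> l = nu.
  by move=> l0 /dzL[] h; have [/eqP h1 h2] := nu_unique l l0; auto.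
have EV l := is_eigenvalueP L0 cP1 cP2 ev1 ev2 hf1 hf2 yE zE l.
split; [|split; [|split]].
- exists mu0, mu1, nu; do 3!split => //; split.
    move=> l; split=> [[/EV[] d l0]|].
    + by have [] := dyneg l (ltW l0) d; auto.
    + by have := dzneg l l0 d; auto.
    + by case=> [|[]] ->; split=> //; apply/EV; auto.
  have dzmu l : l < nu -> dz l (L / 2) != 0.
    move=> ln; apply/eqP => /(dzneg l (lt_trans ln nu0)) e.
    by rewrite e ltxx in ln.
  split; [|split].
  + by apply: (simple_eig_first L0 cP1 cP2 ev1 ev2 hf1 hf2 yE zE) => //; apply: dzmu; exact: lt_trans m1nu.
  + by apply: (simple_eig_first L0 cP1 cP2 ev1 ev2 hf1 hf2 yE zE) => //; exact: dzmu.
  + exists (fun=> 0), (fun x => 1 * z nu x).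
    apply: (simple_eig_second L0 cP1 cP2 ev1 ev2 hf1 hf2 yE zE) => //.
    apply/eqP => /(dyneg nu (ltW nu0))[] e; move: m1nu; rewrite e ?ltxx //.
    by move=> /(lt_trans m01); rewrite ltxx.
- have E : phi = fun x => a * z 0 x by apply/funext => x; have [] := zphi x.
  (* Zero is a Dirichlet value at L/4 for the second component, since phi is odd about L/4. *)
  have z0T : z 0 (L / 4) = 0.
    have [/esym/eqP + _] := zphi (L / 4); rewrite phiT mulf_eq0 gt_eqF //= => /eqP.
    by [].
  have := simple_eig_second L0 cP1 cP2 ev1 ev2 hf1 hf2 yE zE (l := 0) (c := a).
  rewrite -E; apply.
  + by rewrite gt_eqF.
  + by apply/eqP => /(dyneg 0 (lexx 0))[] e; [move: m00|move: m10]; rewrite -e ltxx.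
  + by apply/dzL; left.
- by move=> l /(spectrum_eigenvalue L0 cP1 cP2 ev1 ev2 hf1 hf2 yE zE) /EV.
- by move=> l _; exact: (spectrum_discrete L0 cP1 cP2 ev1 ev2 hf1 hf2 yE zE).
Qed.
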